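(* For every $1/2<s<1$ there exists $\epsilon_0=\epsilon_0(s)>0$ (one may take $\epsilon_0=(2s-1)/6$ if $s\le3/4$ and $\epsilon_0=(1-s)/3$ if $s>3/4$), an absolute constant $K$ and a constant $K_s$ such that: whenever $C,R>0$, $W$ is a $(2s,C)$-Frostman random variable in $\mathbb{R}^2$ with range contained in $B(0,R)$, and $W'$ is an independent copy of $W$, then for all $n\in\mathbb{N}$, $$H_n(|W-W'|^2)\ge n(s+\epsilon_0)-K\log_+C-K\log_+R-K_s.$$
   Context: Logarithms base 2, $\log_+x=\max\{\log x,0\}$. $D_n(x)=\lfloor 2^nx\rfloor/2^n$; $H_n(Z):=H(D_n(Z))$, the Shannon entropy. A random variable $W$ in $\mathbb{R}^2$ is $(\sigma,C)$-Frostman if $P(W\in B(x,r))\le Cr^\sigma$ for all $x$, $r>0$. *)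

(* Defs.v *)
From HB Require Import structures.
From mathcomp Require Import all_boot all_order all_algebra.
From mathcomp Require Import all_classical all_reals all_analysis.
Set Implicit Arguments. Unset Strict Implicit. Unset Printing Implicit Defensive.
Import Order.TTheory GRing.Theory Num.Theory.
Local Open Scope classical_set_scope.
Local Open Scope ring_scope.

Section defs.
Variable R : realType.

Definition log2 (x : R) : R := ln x / ln 2.
Definition logp (x : R) : R := Num.max (log2 x) 0.

Definition Dn (n : nat) (x : R) : R := (Num.floor (2 ^+ n * x))%:~R / 2 ^+ n.

Definition norm2 (x : R * R) : R := Num.sqrt (x.1 ^+ 2 + x.2 ^+ 2).
Definition ball2 (x : R * R) (r : R) : set (R * R) :=
  [set y | norm2 (y.1 - x.1, y.2 - x.2) < r].

Definition entropy d (T : measurableType d) (P : probability T R) (X : T -> R)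
  : \bar R :=
  (\esum_(v in [set: R])
     (let p := fine (P (X @^-1` [set v])) in (- (p * log2 p))%:E))%E.

Definition Hn d (T : measurableType d) (P : probability T R) (n : nat)
  (Z : T -> R) : \bar R := entropy P (fun t => Dn n (Z t)).

Definition frostman d (T : measurableType d) (P : probability T R)
  (W : T -> R * R) (sigma C : R) : Prop :=
  forall (x : R * R) (r : R), 0 < r ->
    (P (W @^-1` ball2 x r) <= (C * r `^ sigma)%:E)%E.

Definition independent2 d (T : measurableType d) (P : probability T R)
  (X Y : T -> R * R) : Prop :=
  forall A B : set (R * R), measurable A -> measurable B ->
    P (X @^-1` A `&` Y @^-1` B) = (P (X @^-1` A) * P (Y @^-1` B))%E.

Definition same_distr d (T : measurableType d) (P : probability T R)
  (X Y : T -> R * R) : Prop :=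
  forall A : set (R * R), measurable A -> P (X @^-1` A) = P (Y @^-1` A).

Definition eps0 (s : R) : R :=
  if s <= 3 / 4 then (2 * s - 1) / 6 else (1 - s) / 3.

End defs.

(* Main.v *)
Require Import Defs.
From HB Require Import structures.
From mathcomp Require Import all_boot all_order all_algebra.
From mathcomp Require Import all_classical all_reals all_analysis.
From mathcomp Require Import measurable_realfun ring lra.
Set Implicit Arguments. Unset Strict Implicit. Unset Printing Implicit Defensive.
Import Order.TTheory GRing.Theory Num.Theory.
Import numFieldNormedType.Exports.
Local Open Scope classical_set_scope.
Local Open Scope ring_scope.

(** The collision probability of [D_n(|W - W'|^2)] is bounded by Falconer's
Fourier-analytic argument, which reaches every exponent below
[min(2s - 1/2, 1)], in particular [s + eps0 s]; and Shannon entropy dominates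
collision entropy.

Put [V = (W - W') / Rad], [beta = s + eps0 s + 1/2] and [alpha = beta - 1/2], so
that [1 < beta < min(2s, 3/2)].  Since [V] is a difference of i.i.d. variables,
[E cos(xi . V) = |E exp(i xi . W / Rad)|^2 >= 0] for every frequency [xi].  Hence,
if [Phi] is the average of a planar Fejer kernel of order [N] over the circle of
radius [r], then [E Phi(V)] is a sum of nonnegative terms weighted by the Fourier
coefficients of the circle, which are [O(|r xi|^(-1/2))].  The sum of
[E cos(xi . V)] over a box of frequencies of size [M] is controlled by the mean of
a Fejer kernel, thus by [M^(2 - beta)] times the [beta]-energy of [V], which is
finite because [beta < 2s].  As [Phi >= c N^3] on the annulus
[||x| - r| <= 1/(2N)], this yields [P(||V| - r| <= 1/(2N)) = O(r^(-1/2) N^(-alpha))].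
The factors [r^(-beta)] which appear when [|V|^2] is cut into intervals are
absorbed by the energy once more. *)

(** * Trigonometric estimates *)

Section trig.
Variable R : realType.
Implicit Types x y : R.

(** Nonnegativity of [E cos(xi . V)] keeps the estimates one-sided: only an upper bound for the
    coefficients of the circle is required, and frequencies may be added or overcounted freely in an
    upper bound. A dyadic shell of frequencies of size [M] contributes about
    [M^(-1/2) M^(2 - beta) = M^(3/2 - beta)]. As [beta < 3/2], these contributions grow
    geometrically and the shell [M = N] dominates. Each frequency arises from at most [N^2] pairs of
    indices, so division by [N^3] leaves [N^(1/2 - beta)]. The inequality [beta < 3/2] is also the
    ceiling [alpha < 1] of the method. Dividing by [Rad] puts [V] in the disc of radius 2, inside
    one period of the Fejer kernel, where the kernel decays like [|x|^(-2)]. *)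

Lemma ger0_is_derive_le (f df : R -> R) (a b : R) :
  (forall x, is_derive x 1 f (df x)) -> a <= b ->
  (forall x, a <= x <= b -> 0 <= df x) -> f a <= f b.
Proof.
move=> fdf ab df0.
have [|c cab fE] := MVT_segment ab (fun x _ => fdf x).
  apply: derivable_within_continuous => x _.
  by have [] := fdf x.
by rewrite -subr_ge0 fE mulr_ge0 ?subr_ge0// df0.
Qed.

Lemma sin_le_id x : 0 <= x -> sin x <= x.
Proof.
move=> x0; rewrite -subr_ge0.
have := @ger0_is_derive_le (fun y => y - sin y) (fun y => 1 - cos y) 0 x.
rewrite sin0 subr0; by apply => // y _; rewrite subr_ge0 cos_le1.
Qed.

Lemma cos_ge_quadratic x : 1 - x ^+ 2 / 2 <= cos x.
Proof.
wlog x0 : x / 0 <= x.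
  move=> h; have [/h//|/ltW xN] := leP 0 x.
  by have := h (- x); rewrite sqrrN cosN oppr_ge0; exact.
have := @ger0_is_derive_le (fun y => cos y + 2^-1 *: (y ^+ 2)) (fun y => y - sin y) 0 x.
rewrite cos0 expr0n/= scaler0 addr0 => /(_ _ x0) h.
have {}h : 1 <= cos x + 2^-1 * x ^+ 2.
  apply: h => [y|y /andP[y0 _]]; last by rewrite subr_ge0 sin_le_id.
  by apply: is_derive_eq; rewrite /GRing.scale/=; lra.
by lra.
Qed.

Lemma cos_ge_half x : `|x| <= 1 -> 1 / 2 <= cos x.
Proof.
move=> x1; apply: le_trans (cos_ge_quadratic x).
have : x ^+ 2 <= 1 by rewrite -real_normK ?num_real// exprn_ile1.
lra.
Qed.

Lemma sin_ge_half x : 0 <= x <= 1 -> x / 2 <= sin x.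
Proof.
move=> /andP[x0 x1].
have := @ger0_is_derive_le (fun y => sin y - 2^-1 *: y) (fun y => cos y - 2^-1) 0 x.
rewrite sin0 scaler0 subr0 subr_ge0 /GRing.scale/= mulrC; apply => // [y|y /andP[y0 yx]].
  by apply: is_derive_eq; rewrite /GRing.scale/= mulr1.
have := @cos_ge_half y; rewrite ger0_norm// => /(_ (le_trans yx x1)).
lra.
Qed.

Lemma lipschitz_of_derive (f df : R -> R) x y :
  (forall x, is_derive x 1 f (df x)) -> (forall x, `|df x| <= 1) ->
  `|f x - f y| <= `|x - y|.
Proof.
move=> fdf df1; wlog xy : x y / x <= y.
  move=> h; have [/h//|/ltW/h] := leP x y.
  by rewrite distrC [leRHS]distrC.
have [|c cab fE] := MVT_segment xy (fun x _ => fdf x).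
  apply: derivable_within_continuous => z _.
  by have [] := fdf z.
by rewrite distrC fE normrM distrC ler_piMl.
Qed.

Lemma cos_lipschitz x y : `|cos x - cos y| <= `|x - y|.
Proof.
apply: (lipschitz_of_derive (df := fun x => - sin x)) => // z.
by rewrite normrN sin_max.
Qed.

Lemma sin_lipschitz x y : `|sin x - sin y| <= `|x - y|.
Proof. by apply: (lipschitz_of_derive (df := cos)) => // z; exact: cos_max. Qed.

Lemma polar_angle x y : x ^+ 2 + y ^+ 2 = 1 ->
  exists2 t : R, 0 <= t <= 2 * pi & cos t = x /\ sin t = y.
Proof.
move=> xy1.
have x1 : -1 <= x <= 1.
  rewrite -ler_norml -(@ler_pXn2r _ 2) ?nnegrE// real_normK ?num_real// expr1n.
  by rewrite -xy1 lerDl sqr_ge0.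
have xin : x \in `[(-1), 1] by rewrite in_itv.
have yE : Num.sqrt (1 - x ^+ 2) = `|y|.
  by rewrite -xy1 addrAC subrr add0r sqrtr_sqr.
have [y0|y0] := leP 0 y.
  exists (acos x).
    rewrite acos_ge0//=; apply: le_trans (acos_lepi x1) _.
    by have := @pi_ge0 R; lra.
  by rewrite acosK// sin_acos// yE ger0_norm.
(* [acos] only reaches the upper half circle; the lower half is its reflection, shifted by a period
   to stay in the range of integration. *)
exists (2 * pi - acos x).
  have := acos_lepi x1; have := acos_ge0 x1; have := @pi_ge0 R; lra.
have -> : 2 * pi - acos x = - acos x + pi *+ 2 by rewrite mulr_natl addrC.
rewrite cosD2pi sinD2pi cosN sinN acosK// sin_acos// yE ltr0_norm//.
by rewrite opprK.
Qed.

End trig.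

(** * Decay of the Fourier transform of the circle *)

Section bessel.
Variable R : realType.
Variables A B : R.
Let L : R := Num.sqrt (A ^+ 2 + B ^+ 2).
Let p (t : R) : R := A * cos t + B * sin t.
Let p' (t : R) : R := B * cos t - A * sin t.

Let dp (t : R) : is_derive t 1 p (p' t).
Proof. rewrite /p; apply: is_derive_eq; rewrite /GRing.scale/= /p'; ring. Qed.
Let dp' (t : R) : is_derive t 1 p' (- p t).
Proof. rewrite /p'; apply: is_derive_eq; rewrite /GRing.scale/= /p; ring. Qed.
Let pp' t : p t ^+ 2 + p' t ^+ 2 = L ^+ 2.
Proof.
rewrite sqr_sqrtr ?addr_ge0 ?sqr_ge0//.
have -> : p t ^+ 2 + p' t ^+ 2 = (A ^+ 2 + B ^+ 2) * (cos t ^+ 2 + sin t ^+ 2).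
  by rewrite /p /p'; ring.
by rewrite cos2Dsin2 mulr1.
Qed.

Hypothesis L0 : 0 < L.
Let K : R := Num.sqrt L.
Let K0 : 0 < K. Proof. by rewrite sqrtr_gt0. Qed.
Let KL : K ^+ 2 = L. Proof. by rewrite sqr_sqrtr// ltW. Qed.
Let q t : R := p' t ^+ 2 + L.
Let q0 t : 0 < q t.
Proof. by rewrite /q ltr_wpDl// sqr_ge0. Qed.

(* The first term comes from integrating [cos p] by parts after inserting the weight
[p'^2 / (p'^2 + L)], which vanishes at the stationary points; the second one is a
primitive that controls the integral of the complementary weight [L / (p'^2 + L)]
up to bounded terms.  Both are periodic, so they disappear after integration. *)
Let H (t : R) : R := sin (p t) * p' t * (q t)^-1 - 2 / K ^+ 3 * (p t * atan (K^-1 * p' t)).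
Let H' (t : R) : R :=
  cos (p t) * p' t ^+ 2 / q t - sin (p t) * p t * (L - p' t ^+ 2) / q t ^+ 2
  + 2 / K ^+ 3 * (K * p t ^+ 2 / q t) - 2 / K ^+ 3 * (p' t * atan (K^-1 * p' t)).

Let dH (t : R) : is_derive t 1 H (H' t).
Proof.
have dsp : is_derive t 1 (sin \o p) (cos (p t) * p' t).
  exact: is_derive1_comp.
have dq : is_derive t 1 q (- (p' t * p t) *+ 2).
  rewrite /q; apply: is_derive_eq; rewrite /GRing.scale/= /p /p'; ring.
have dqi : is_derive t 1 (fun x => (q x)^-1) (- (q t) ^- 2 *: (- (p' t * p t) *+ 2)).
  by apply: is_deriveV => //; rewrite gt_eqF.
have dat : is_derive t 1 (atan \o (K^-1 \*: p')) ((1 + (K^-1 * p' t) ^+ 2)^-1 * (K^-1 * - p t)).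
  have dKp : is_derive t 1 (K^-1 \*: p' : R -> R) (K^-1 * - p t).
    exact: is_deriveZ.
  exact: (is_derive1_comp (is_derive1_atan _) dKp).
have -> : H = (((sin \o p) * p' : R -> R) * (fun x => (q x)^-1) : R -> R)
   - ((2 / K ^+ 3) \*: (p * (atan \o (K^-1 \*: p')) : R -> R) : R -> R).
  by apply/funext => x; rewrite /H.
apply: is_derive_eq; rewrite /GRing.scale/= /H'.
have qn0 : q t != 0 by rewrite gt_eqF.
have Kn0 : K != 0 by rewrite gt_eqF.
have -> : (1 + (K^-1 * p' t) ^+ 2)^-1 = K ^+ 2 / q t.
  rewrite /q -KL; field; rewrite Kn0/= KL -/(q t) qn0 //.
have -> : L = q t - p' t ^+ 2 by rewrite /q; ring.
rewrite [B * - sin t - A * cos t](_ : _ = - p t); last by rewrite /p; ring.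
rewrite [A * - sin t + B * cos t](_ : _ = p' t); last by rewrite /p'; ring.
rewrite [((sin \o p : R -> R) * p') t](_ : _ = sin (p t) * p' t)//.
rewrite [K^-1 *: p' t](_ : _ = K^-1 * p' t)//.
field.
by rewrite Kn0 qn0.
Qed.

Let H_periodic : H (2 * pi) = H 0.
Proof.
have -> : 2 * pi = pi *+ 2 :> R by rewrite mulr_natl.
by rewrite /H /q /p /p' cos2pi sin2pi cos0 sin0.
Qed.

(** Two errors separate [H'] from [cos p]: the part of [cos p] under the complementary weight, and
    the derivative of [p' / q]. Each is at most [L / q] ([e1], [e2]). By [p^2 + p'^2 = L^2] the
    arctangent term supplies [2 L / q] up to lower order ([e4]), which pays for both; what remains
    is [O(1 / K)]. *)
Let cos_le_H' t : 1 <= L -> cos (p t) <= H' t + (2 * pi + 4) / K.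
Proof.
move=> L1.
have K1 : 1 <= K by rewrite -sqrtr1 ler_sqrt ?(le_trans ler01).
have Kn0 : K != 0 by rewrite gt_eqF.
have qn0 : q t != 0 by rewrite gt_eqF.
have q_ge0 := ltW (q0 t).
have pi0 := @pi_ge0 R.
have pL : `|p t| <= L.
  rewrite -(@ler_pXn2r _ 2) ?nnegrE ?(ltW L0)// real_normK ?num_real//.
  by rewrite -(pp' t) lerDl sqr_ge0.
have p'L : `|p' t| <= L.
  rewrite -(@ler_pXn2r _ 2) ?nnegrE ?(ltW L0)// real_normK ?num_real//.
  by rewrite -(pp' t) lerDr sqr_ge0.
have e1 : cos (p t) * L / q t <= L / q t.
  by rewrite ler_pM2r ?invr_gt0// ler_piMl ?cos_le1// ltW.
have e2 : sin (p t) * p t * (L - p' t ^+ 2) / q t ^+ 2 <= L / q t.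
  apply: le_trans (ler_norm _) _.
  rewrite !normrM normfV [`|q t ^+ 2|]ger0_norm ?sqr_ge0//.
  rewrite expr2 invfM mulrA ler_pM2r ?invr_gt0// ler_pdivrMr//.
  rewrite ler_pM//; first by rewrite -[L]mul1r ler_pM// sin_max.
  rewrite ler_norml /q; have := sqr_ge0 (p' t); have := ltW L0; lra.
have e3 : 2 / K ^+ 3 * (p' t * atan (K^-1 * p' t)) <= pi / K.
  apply: le_trans (_ : 2 / K ^+ 3 * (L * (pi / 2)) <= _); last first.
    rewrite -KL le_eqVlt; apply/orP; left; apply/eqP; field; exact: Kn0.
  rewrite ler_pM2l ?divr_gt0 ?exprn_gt0//.
  apply: le_trans (ler_norm _) _; rewrite normrM ler_pM// ler_norml.
  by rewrite ltW ?atan_gtNpi2// ltW// atan_ltpi2.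
have -> : cos (p t) = cos (p t) * p' t ^+ 2 / q t + cos (p t) * L / q t.
  rewrite -mulrDl -mulrDr; change (p' t ^+ 2 + L) with (q t).
  by rewrite mulfK.
have e4 : 2 / K ^+ 3 * (K * p t ^+ 2 / q t) = 2 * L / q t - 2 / L + 2 / q t.
  have -> : p t ^+ 2 = L ^+ 2 - (q t - L) by rewrite -(pp' t) /q; ring.
  rewrite -KL; field; rewrite Kn0 qn0//.
have e5 : 2 / L <= 2 / K.
  by rewrite ler_pM2l// lef_pV2 ?posrE// -KL expr2 ler_peMl// ltW.
have e6 : 0 <= 2 / q t by rewrite divr_ge0.
have e7 : 0 <= pi / K by rewrite divr_ge0// ltW.
have e8 : 0 <= 2 / K by rewrite divr_ge0// ltW.
have e9 : (2 * pi + 4) / K = 2 * (pi / K) + 2 * (2 / K) by field.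
have e10 : 2 * L / q t = 2 * (L / q t) by rewrite mulrA.
rewrite /H' e9; lra.
Qed.

Let cont_of_derive (f df : R -> R) : (forall t : R, is_derive t 1 f (df t)) -> continuous f.
Proof.
by move=> fdf t; apply/differentiable_continuous/derivable1_diffP; have [] := fdf t.
Qed.

Let continuous_H' : continuous H'.
Proof.
have cp := cont_of_derive dp; have cp' := cont_of_derive dp'.
have cq : continuous q.
  by move=> t; apply: cvgD; [apply: cvgM; exact: cp'|exact: cvg_cst].
have cqi : continuous (fun t => (q t)^-1).
  by move=> t; apply: cvgV; [rewrite gt_eqF|exact: cq].
have ccp : continuous (fun t => cos (p t)).
  by move=> t; apply: continuous_comp; [exact: cp|exact: continuous_cos].
have csp : continuous (fun t => sin (p t)).
  by move=> t; apply: continuous_comp; [exact: cp|exact: continuous_sin].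
have cp'2 : continuous (fun t => p' t ^+ 2) by move=> t; apply: cvgM; exact: cp'.
have cp2 : continuous (fun t => p t ^+ 2) by move=> t; apply: cvgM; exact: cp.
have cqi2 : continuous (fun t => (q t ^+ 2)^-1).
  move=> t; apply: cvgV; first by rewrite expf_eq0 gt_eqF.
  by apply: cvgM; exact: cq.
have cat : continuous (fun t => atan (K^-1 * p' t)).
  move=> t; apply: continuous_comp; last exact: continuous_atan.
  by apply: cvgM; [exact: cvg_cst|exact: cp'].
move=> t; rewrite /H'.
apply: cvgB.
  apply: cvgD.
    apply: cvgB.
      apply: cvgM; last exact: cqi.
      by apply: cvgM; [exact: ccp|exact: cp'2].
    apply: cvgM; last exact: cqi2.
    apply: cvgM; first by apply: cvgM; [exact: csp|exact: cp].
    by apply: cvgB; [exact: cvg_cst|exact: cp'2].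
  apply: cvgM; first exact: cvg_cst.
  apply: cvgM; last exact: cqi.
  by apply: cvgM; [exact: cvg_cst|exact: cp2].
apply: cvgM; first exact: cvg_cst.
by apply: cvgM; [exact: cp'|exact: cat].
Qed.

Let mu := @lebesgue_measure R.
Let D : set R := [set` `[0, 2 * pi]].

Let cont_int (f : R -> R) : continuous f -> mu.-integrable D (EFin \o f).
Proof.
move=> cf; apply: continuous_compact_integrable; first exact: segment_compact.
exact: continuous_subspaceT.
Qed.

Let int_H' : \int[mu]_(t in D) H' t = 0.
Proof.
have tp : (0 : R) < 2 * pi by rewrite mulr_gt0// pi_gt0.
rewrite /Rintegral (@continuous_FTC2 _ H' H 0 (2 * pi))//.
- by rewrite H_periodic subee.
- exact: continuous_subspaceT.
- have cH := cont_of_derive dH; split.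
  + by move=> x _; have [] := dH x.
  + exact/cvg_at_right_filter/cH.
  + exact/cvg_at_left_filter/cH.
- by move=> x _; rewrite derive1E; apply: derive_val.
Qed.

Lemma bessel_decay_ge1 : 1 <= L ->
  \int[mu]_(t in D) cos (A * cos t + B * sin t) <= (2 * pi + 4) / K * (2 * pi).
Proof.
move=> L1; have mD : measurable D by exact: measurable_itv.
have muD : mu D = (2 * pi)%:E.
  rewrite /mu /D lebesgue_measure_itv/= lte_fin mulr_gt0 ?pi_gt0//.
  by rewrite oppr0 adde0.
have ccp : continuous (fun t => cos (p t)).
  move=> t; apply: continuous_comp; last exact: continuous_cos.
  exact: (cont_of_derive dp).
have cst_int (r : R) : mu.-integrable D (EFin \o (fun=> r)).
  by apply: cont_int => t; exact: cvg_cst.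
apply: le_trans (_ : \int[mu]_(t in D) (H' t + (2 * pi + 4) / K) <= _).
  apply: le_Rintegral => //.
  - exact: (cont_int ccp).
  - apply: cont_int => t; apply: cvgD; last exact: cvg_cst.
    exact: continuous_H'.
  - by move=> t _; exact: cos_le_H'.
rewrite RintegralD//; last exact: (cont_int continuous_H').
have fmuD : fine (mu D) = 2 * pi by rewrite muD.
rewrite int_H' add0r Rintegral_cst// -fmuD; exact: lexx.
Qed.

End bessel.

(** No absolute value is taken, since these integrals will only be multiplied by nonnegative
    numbers. When the frequency has modulus below 1, the trivial bound [2 * pi] is already smaller
    than the right-hand side. *)
Lemma bessel_decay (R : realType) (A B : R) : A ^+ 2 + B ^+ 2 != 0 ->
  \int[@lebesgue_measure R]_(t in [set` `[0, 2 * pi]]) cos (A * cos t + B * sin t)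
    <= (2 * pi + 4) * (2 * pi) / Num.sqrt (Num.sqrt (A ^+ 2 + B ^+ 2)).
Proof.
move=> AB0.
have AB : 0 < A ^+ 2 + B ^+ 2 by rewrite lt_neqAle eq_sym AB0 addr_ge0 ?sqr_ge0.
have L0 : 0 < Num.sqrt (A ^+ 2 + B ^+ 2) by rewrite sqrtr_gt0.
have K0 : 0 < Num.sqrt (Num.sqrt (A ^+ 2 + B ^+ 2)) by rewrite sqrtr_gt0.
have pi0 := @pi_gt0 R; have pi2 := @pi_ge2 R.
have [L1|L1] := leP 1 (Num.sqrt (A ^+ 2 + B ^+ 2)).
  by have := bessel_decay_ge1 L0 L1; rewrite mulrAC.
have K1 : Num.sqrt (Num.sqrt (A ^+ 2 + B ^+ 2)) <= 1.
  by rewrite -[leRHS]sqrtr1 ler_sqrt// ltW.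
have tp : (0 : R) < 2 * pi by rewrite mulr_gt0.
set D := [set` _].
have mD : measurable D by exact: measurable_itv.
have muD : lebesgue_measure D = (2 * pi)%:E.
  by rewrite /D lebesgue_measure_itv/= lte_fin tp oppr0 adde0.
apply: le_trans (_ : \int[lebesgue_measure]_(t in D) 1 <= _).
  apply: le_Rintegral => //.
  - apply: continuous_compact_integrable; first exact: segment_compact.
    apply: continuous_subspaceT => t; apply: continuous_comp; last exact: continuous_cos.
    apply: cvgD; apply: cvgM; first exact: cvg_cst.
    - exact: continuous_cos.
    - exact: cvg_cst.
    - exact: continuous_sin.
  - apply: continuous_compact_integrable; first exact: segment_compact.
    by apply: continuous_subspaceT => t; exact: cvg_cst.
have fmuD : fine (lebesgue_measure D) = 2 * pi by rewrite muD.
rewrite Rintegral_cst// mul1r.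
apply: le_trans (_ : 2 * pi <= _); first by rewrite -fmuD; exact: lexx.
rewrite ler_pdivlMr//.
rewrite [leRHS]mulrC ler_pM2l//; lra.
Qed.

(** * Sums over differences of indices *)

Section counting.
Variable R : realDomainType.

Lemma ler_sum_subrange (F : nat -> R) (P : pred nat) m1 n1 m2 n2 :
  (forall i, 0 <= F i) ->
  (forall i, (m1 <= i < n1)%N -> P i -> (m2 <= i < n2)%N) ->
  \sum_(m1 <= i < n1 | P i) F i <= \sum_(m2 <= i < n2) F i.
Proof.
move=> F0 sub.
rewrite (@big_nat_widenl _ _ _ m1 0)// (@big_nat_widen _ _ _ 0 n1 (maxn n1 n2)) ?leq_maxl//.
rewrite (@big_nat_widenl _ _ _ m2 0)// (@big_nat_widen _ _ _ 0 n2 (maxn n1 n2)) ?leq_maxr//.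
rewrite [leLHS]big_mkcond [leRHS]big_mkcond/=; apply: ler_sum => i _.
case: ifP => [/andP[/andP[Pi m1i] in1]|_]; last by case: ifP.
by have /andP[-> ->] := sub i (introT andP (conj m1i in1)) Pi.
Qed.

Variable g : R -> R.
Hypothesis g0 : forall x, 0 <= g x.

(** For fixed [l] the differences [k - l] are distinct and lie strictly between [- M] and [M]; the
    natural number [a = k - l + M] indexes them. *)
Lemma sum_window_le (N M l : nat) :
  \sum_(k < N | (k < l + M)%N && (l < k + M)%N) g (k%:R - l%:R)
  <= \sum_(a < 2 * M) g (a%:R - M%:R).
Proof.
rewrite -(big_mkord (fun k => (k < l + M)%N && (l < k + M)%N)
  (fun k => g (k%:R - l%:R))).
rewrite -(big_mkord xpredT (fun a => g (a%:R - M%:R))).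
have -> : \sum_(0 <= a < 2 * M) g (a%:R - M%:R) =
    \sum_(0 + l <= i < l + 2 * M) g (i%:R - (l + M)%:R).
  rewrite big_addn addKn; apply: eq_bigr => i _.
  by congr g; rewrite !natrD opprD addrA addrK.
have -> : \sum_(0 <= k < N | (k < l + M)%N && (l < k + M)%N) g (k%:R - l%:R) =
    \sum_(0 + M <= i < N + M | (i - M < l + M)%N && (l < i - M + M)%N) g (i%:R - (l + M)%:R).
  rewrite big_addn addnK.
  under [RHS]eq_bigl => i do rewrite addnK.
  apply: eq_bigr => i _.
  by congr g; rewrite !natrD opprD [- _ - _]addrC addrA addrK.
apply: ler_sum_subrange => // i; rewrite !add0n => /andP[Mi iN] /andP[].
by rewrite subnK// ltn_subLR// => ? /ltnW ->/=; rewrite mul2n -addnn addnA addnC.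
Qed.

(** Each difference [a - M] is realised by at least [M] pairs: [l] runs over [[M, 2M)] and
    [k = l + a - M] stays below [3M]. The range [4 * M] leaves slack, so that a dyadic [M] gives a
    dyadic range. *)
Lemma sum_window_ge (M : nat) :
  M%:R * (\sum_(a < 2 * M) g (a%:R - M%:R))
  <= \sum_(k < 4 * M) \sum_(l < 4 * M) g (k%:R - l%:R).
Proof.
rewrite exchange_big/= -(big_mkord xpredT (fun l => \sum_(k < 4 * M) g (k%:R - l%:R))).
apply: le_trans (_ : \sum_(M <= l < M + M) (\sum_(a < 2 * M) g (a%:R - M%:R)) <= _).
  by rewrite sumr_const_nat addKn mulr_natl.
apply: le_trans (_ : \sum_(M <= l < M + M) (\sum_(k < 4 * M) g (k%:R - l%:R)) <= _).
  rewrite big_nat_cond [leRHS]big_nat_cond; apply: ler_sum => l /andP[/andP[Ml lM] _].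
  rewrite -(big_mkord xpredT (fun a => g (a%:R - M%:R))).
  rewrite -(big_mkord xpredT (fun k => g (k%:R - l%:R))).
  have -> : \sum_(0 <= a < 2 * M) g (a%:R - M%:R) =
      \sum_(0 + (l - M) <= i < 2 * M + (l - M)) g (i%:R - l%:R).
    rewrite big_addn addnK; apply: eq_bigr => i _.
    congr g; rewrite natrD natrB//; ring.
  apply: ler_sum_subrange => // i /andP[_ +] _ /=.
  move=> /leq_trans; apply; rewrite -[4%N]/(2 + 2)%N mulnDl leq_add2l.
  by rewrite leq_subLR mul2n -addnn (leq_trans (ltnW lM))// leq_add2l leq_addr.
apply: ler_sum_subrange => [i|i /andP[_ iM] _].
  exact: sumr_ge0.
by rewrite leq0n (leq_trans iM)// addnn -mul2n leq_mul2r orbT.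
Qed.

End counting.

Section counting2.
Variables (R : realDomainType) (q : R -> R -> R).
Hypothesis q0 : forall x y, 0 <= q x y.

Definition box_sum (M : nat) : R :=
  \sum_(a < 2 * M) \sum_(b < 2 * M) q (a%:R - M%:R) (b%:R - M%:R).

Lemma box_sum_window (N M l1 l2 : nat) :
  \sum_(k1 < N | (k1 < l1 + M)%N && (l1 < k1 + M)%N)
   \sum_(k2 < N | (k2 < l2 + M)%N && (l2 < k2 + M)%N) q (k1%:R - l1%:R) (k2%:R - l2%:R)
  <= box_sum M.
Proof.
pose G x := \sum_(b < 2 * M) q x (b%:R - M%:R).
have G0 x : 0 <= G x by exact: sumr_ge0.
apply: le_trans (sum_window_le G0 N M l1).
by apply: ler_sum => k1 _; exact: sum_window_le.
Qed.

(** Each coordinate yields one factor [M] by [sum_window_ge]. When [q] is the mean of the cosines of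
    [V], the right-hand side is the mean of [fejer2 (4 * M)], so that box sums are recovered from
    Fejer means. *)
Lemma box_sum_le (M : nat) :
  M%:R ^+ 2 * box_sum M <= \sum_(k1 < 4 * M) \sum_(k2 < 4 * M)
    \sum_(l1 < 4 * M) \sum_(l2 < 4 * M) q (k1%:R - l1%:R) (k2%:R - l2%:R).
Proof.
under [leRHS]eq_bigr => k1 _ do rewrite exchange_big.
rewrite expr2 -mulrA.
apply: le_trans (_ : M%:R * \sum_(a < 2 * M) (\sum_(k2 < 4 * M) \sum_(l2 < 4 * M)
    q (a%:R - M%:R) (k2%:R - l2%:R)) <= _).
  rewrite ler_wpM2l// mulr_sumr; apply: ler_sum => a _.
  exact: sum_window_ge.
apply: (@sum_window_ge _ (fun x => \sum_(k2 < 4 * M) \sum_(l2 < 4 * M)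
    q x (k2%:R - l2%:R))) => x.
by apply: sumr_ge0 => i _; exact: sumr_ge0.
Qed.

End counting2.

(** * Fejer kernels *)

Section fejer.
Variable R : realType.
Implicit Types x y : R.

Definition csum (N : nat) x : R := \sum_(k < N) cos (k%:R * x).
Definition ssum (N : nat) x : R := \sum_(k < N) sin (k%:R * x).
(** This is [|sum_(k < N) exp(i k x)|^2], that is [N] times the usual Fejer kernel: the peak has
    height [N^2] and width about [1 / N]. *)
Definition fejer (N : nat) x : R := csum N x ^+ 2 + ssum N x ^+ 2.
Definition fejer2 (N : nat) x y : R := fejer N x * fejer N y.

Lemma fejer_ge0 N x : 0 <= fejer N x.
Proof. by rewrite addr_ge0 ?sqr_ge0. Qed.

Lemma fejer2_ge0 N x y : 0 <= fejer2 N x y.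
Proof. by rewrite mulr_ge0 ?fejer_ge0. Qed.

Lemma fejerE N x : fejer N x = \sum_(k < N) \sum_(l < N) cos ((k%:R - l%:R) * x).
Proof.
rewrite /fejer !expr2 !big_distrlr -big_split/=; apply: eq_bigr => k _.
by rewrite -big_split/=; apply: eq_bigr => l _; rewrite mulrBl cosB.
Qed.

Let fejer_sin0 N x : \sum_(k < N) \sum_(l < N) sin ((k%:R - l%:R) * x) = 0.
Proof.
set S := LHS; suff : S = - S by lra.
rewrite /S [LHS]exchange_big/= -sumrN; apply: eq_bigr => k _.
rewrite -sumrN; apply: eq_bigr => l _.
by rewrite -sinN -mulNr opprB.
Qed.

(** A product of cosines differs from the cosine of the sum by a product of sines, and the double
    sum of sines vanishes because it is antisymmetric in [k] and [l]. *)
Lemma fejer2E N x y : fejer2 N x y =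
  \sum_(k1 < N) \sum_(k2 < N) \sum_(l1 < N) \sum_(l2 < N)
    cos ((k1%:R - l1%:R) * x + (k2%:R - l2%:R) * y).
Proof.
under eq_bigr => k1 _ do rewrite exchange_big/=.
rewrite /fejer2 !fejerE.
transitivity (\sum_(k1 < N) \sum_(l1 < N)
  (cos ((k1%:R - l1%:R) * x) * (\sum_(k2 < N) \sum_(l2 < N) cos ((k2%:R - l2%:R) * y))
  - sin ((k1%:R - l1%:R) * x) * (\sum_(k2 < N) \sum_(l2 < N) sin ((k2%:R - l2%:R) * y)))).
  rewrite fejer_sin0 mulr_suml; apply: eq_bigr => k1 _.
  by rewrite mulr_suml; apply: eq_bigr => l1 _; rewrite mulr0 subr0.
apply: eq_bigr => k1 _; apply: eq_bigr => l1 _.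
rewrite !mulr_sumr -sumrB; apply: eq_bigr => k2 _.
by rewrite !mulr_sumr -sumrB; apply: eq_bigr => l2 _; rewrite cosD.
Qed.

Lemma fejer_le_sq N x : fejer N x <= N%:R ^+ 2.
Proof.
rewrite fejerE expr2 -natrM.
apply: le_trans (_ : \sum_(k < N) \sum_(l < N) 1 <= _).
  by apply: ler_sum => k _; apply: ler_sum => l _; exact: cos_le1.
by under eq_bigr do rewrite sumr_const card_ord; rewrite sumr_const card_ord -mulrnA.
Qed.

Lemma fejer_ge N x : N%:R * `|x| <= 1 -> N%:R ^+ 2 / 4 <= fejer N x.
Proof.
move=> Nx; apply: le_trans (_ : csum N x ^+ 2 <= _); last by rewrite lerDl sqr_ge0.
have -> : N%:R ^+ 2 / 4 = (N%:R * (1 / 2)) ^+ 2 :> R by field.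
rewrite ler_pXn2r ?nnegrE ?mulr_ge0//.
  have -> : N%:R * (1 / 2) = \sum_(k < N) (1 / 2) :> R.
    by rewrite sumr_const card_ord mulr_natl.
  apply: ler_sum => k _; apply: cos_ge_half; apply: le_trans Nx.
  by rewrite normrM ler_wpM2r// normr_nat ler_nat ltnW.
apply: sumr_ge0 => k _; apply: le_trans (_ : 1 / 2 <= _) => //.
apply: cos_ge_half; apply: le_trans Nx.
by rewrite normrM ler_wpM2r// normr_nat ler_nat ltnW.
Qed.

(** The squared modulus of [(z - 1) sum_(k < N) z^k = z^N - 1] at [z = exp(i x)]; [e1] and [e2] are
    its real and imaginary parts, obtained by telescoping. *)
Lemma fejer_geometric N x :
  fejer N x * (2 - 2 * cos x) = 2 - 2 * cos (N%:R * x).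
Proof.
have kx k : k.+1%:R * x = k%:R * x + x by rewrite -natr1 mulrDl mul1r.
have e1 : csum N x * (cos x - 1) - ssum N x * sin x = cos (N%:R * x) - 1.
  rewrite !mulr_suml -sumrB.
  under eq_bigr => k _ do rewrite mulrBr mulr1 addrAC -cosD -kx.
  rewrite -(big_mkord xpredT (fun k => cos (k.+1%:R * x) - cos (k%:R * x))).
  by rewrite telescope_sumr// mul0r cos0.
have e2 : csum N x * sin x + ssum N x * (cos x - 1) = sin (N%:R * x).
  rewrite !mulr_suml -big_split/=.
  under eq_bigr => k _ do rewrite mulrBr mulr1 addrA [cos _ * sin x + _]addrC -sinD -kx.
  rewrite -(big_mkord xpredT (fun k => sin (k.+1%:R * x) - sin (k%:R * x))).
  by rewrite telescope_sumr// mul0r sin0 subr0.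
have := cos2Dsin2 (N%:R * x); have := cos2Dsin2 x.
move: e1 e2; rewrite /fejer.
set c := csum N x; set s := ssum N x; set C := cos (N%:R * x); set S := sin (N%:R * x).
move=> e1 e2 h1 h2.
have -> : 2 - 2 * cos x = (cos x - 1) ^+ 2 + sin x ^+ 2 by lra.
have -> : 2 - 2 * C = (C - 1) ^+ 2 + S ^+ 2 by lra.
by rewrite -e1 -e2; ring.
Qed.

(** In [fejer_geometric] the right-hand side is at most 4, while
    [2 - 2 cos x = 4 sin^2(x / 2) >= x^2 / 4] as long as [|x| / 2 <= 1]. *)
Lemma fejer_le N x : `|x| <= 2 -> fejer N x * x ^+ 2 <= 16.
Proof.
move=> x2.
have e : x ^+ 2 / 4 <= 2 - 2 * cos x.
  have -> : cos x = cos ((`|x| / 2) *+ 2).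
    by rewrite -[LHS]cos_norm; congr cos; field.
  rewrite cos_mulr2n cos2sin2.
  have h : `|x| / 2 / 2 <= sin (`|x| / 2).
    by apply: sin_ge_half; rewrite divr_ge0//= ler_pdivrMr// mul1r.
  have : (`|x| / 2 / 2) ^+ 2 <= sin (`|x| / 2) ^+ 2.
    by rewrite ler_pXn2r ?nnegrE ?divr_ge0// (le_trans _ h) ?divr_ge0.
  have -> : (`|x| / 2 / 2) ^+ 2 = `|x| ^+ 2 / 16 by field.
  rewrite real_normK ?num_real//; lra.
have := fejer_geometric N x; have := cos_geN1 (N%:R * x); have := fejer_ge0 N x.
nra.
Qed.

End fejer.

(** * Dyadic layers of the energy *)

Section layers.
Variable R : realType.

(* With [b = 2 ^ beta], the functions [layers b m v] approximate [v ^ - beta] from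
both sides, up to constants, for [2 ^ - m <= v < 2]. *)
Definition layers (b : R) (m : nat) (v : R) : R :=
  \sum_(i < m.+1) b ^+ i * (v < 2 / 2 ^+ i)%R%:R.

Lemma layers_ge (b : R) m v i : 0 <= b -> (i <= m)%N -> v < 2 / 2 ^+ i ->
  b ^+ i <= layers b m v.
Proof.
move=> b0 im vi; rewrite /layers (bigD1 (Ordinal (im : (i < m.+1)%N)))//= vi mulr1.
by rewrite lerDl sumr_ge0// => j _; rewrite mulr_ge0// exprn_ge0.
Qed.

(** Here [i] is the dyadic scale of [v] capped at the resolution [m]: for very small [v] only the
    upper bound survives, hence the alternative [i = m]. *)
Lemma dyadic_scale (v : R) m : v < 2 ->
  exists i, [/\ (i <= m)%N, v < 2 / 2 ^+ i & i = m \/ 1 / 2 ^+ i <= v].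
Proof.
move=> v2; elim: m => [|m [i [im vi h]]].
  by exists 0%N; rewrite expr0 divr1; split => //; left.
have [vl|vl] := leP (1 / 2 ^+ i) v; first by exists i; split => //; [exact: leqW|right].
case: h => [iE|]; last by rewrite leNgt vl.
exists m.+1; split => //; last by left.
by rewrite exprS invfM mulrA divff// -iE.
Qed.

(** One coordinate carries at least half of [v^2]; its Fejer factor is at most [32 * 4^i] at scale
    [i], by [fejer_le]. The other factor is bounded by its peak [4^m]. Finally
    [4^i = (4 / b)^i b^i <= (4 / b)^m b^i], which is where [b <= 4] enters, and [b^i] is one of the
    layers. *)
Lemma fejer2_le_layers (b : R) m x y : 0 < b <= 4 -> x ^+ 2 + y ^+ 2 < 4 ->
  fejer2 (2 ^ m) x y <= 32 * (16 / b) ^+ m * layers b m (Num.sqrt (x ^+ 2 + y ^+ 2)).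
Proof.
move=> /andP[b0 b4] xy4; set v := Num.sqrt _.
have s0 : 0 <= x ^+ 2 + y ^+ 2 by rewrite addr_ge0 ?sqr_ge0.
have v0 : 0 <= v by exact: sqrtr_ge0.
have v2E : v ^+ 2 = x ^+ 2 + y ^+ 2 by rewrite sqr_sqrtr.
have v2 : v < 2 by rewrite -(@ltr_pXn2r _ 2) ?nnegrE// v2E; apply: lt_le_trans xy4 _; lra.
have N2 : (2 ^ m)%N%:R ^+ 2 = 4 ^+ m :> R.
  by rewrite natrX -exprM mulnC exprM; congr (_ ^+ _); rewrite expr2; lra.
have b4m i : (i <= m)%N -> (4 / b) ^+ i <= (4 / b) ^+ m.
  by move=> im; apply: ler_weXn2l => //; rewrite ler_pdivlMr// mul1r.
have rhs i : (i <= m)%N -> v < 2 / 2 ^+ i ->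
    32 * 4 ^+ m * 4 ^+ i <= 32 * (16 / b) ^+ m * layers b m v.
  move=> im vi; apply: le_trans (_ : 32 * (16 / b) ^+ m * b ^+ i <= _); last first.
    apply: ler_wpM2l (layers_ge (ltW b0) im vi).
    by rewrite mulr_ge0// exprn_ge0// divr_ge0// ltW.
  rewrite -!mulrA ler_pM2l//.
  have -> : 16 / b = 4 * (4 / b) :> R by field; rewrite gt_eqF.
  have -> : (4 : R) ^+ i = (4 / b) ^+ i * b ^+ i by rewrite -exprMn divfK ?gt_eqF.
  rewrite [(4 * (4 / b)) ^+ m]exprMn -[leRHS]mulrA ler_pM2l ?exprn_gt0//.
  by rewrite ler_pM2r ?exprn_gt0// b4m.
have [i [im vi h]] := dyadic_scale m v2.
apply: le_trans (rhs i im vi).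
have fm (z : R) : fejer (2 ^ m) z <= 4 ^+ m by rewrite -N2; exact: fejer_le_sq.
have f0 (z : R) := fejer_ge0 (2 ^ m) z.
have half (z : R) : z ^+ 2 < 4 -> 1 / 4 ^+ i / 2 <= z ^+ 2 -> fejer (2 ^ m) z <= 32 * 4 ^+ i.
  move=> z4 zi.
  have z2 : `|z| <= 2.
    rewrite -(@ler_pXn2r _ 2) ?nnegrE// real_normK ?num_real//.
    by apply: le_trans (ltW z4) _; lra.
  have i0 : 0 < (4 : R) ^+ i by rewrite exprn_gt0.
  have := fejer_le (2 ^ m) z2.
  have : fejer (2 ^ m) z * (1 / 4 ^+ i / 2) <= fejer (2 ^ m) z * z ^+ 2 by rewrite ler_wpM2l.
  move=> /le_trans h1 /h1; rewrite mulrA ler_pdivrMr// mul1r ler_pdivrMr//; lra.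
case: h => [iE|vl].
  rewrite /fejer2 iE -mulrA; apply: le_trans (ler_pM (f0 x) (f0 y) (fm x) (fm y)) _.
  by rewrite ler_peMl ?mulr_ge0 ?exprn_ge0// ler1n.
have i0 : 0 < (4 : R) ^+ i by rewrite exprn_gt0.
have i4 : 1 / 4 ^+ i <= x ^+ 2 + y ^+ 2.
  rewrite -v2E; have -> : 1 / 4 ^+ i = (1 / 2 ^+ i) ^+ 2 :> R.
    rewrite expr_div_n expr1n -exprM mulnC exprM; congr (_ / _ ^+ _); rewrite expr2; lra.
  by rewrite ler_pXn2r ?nnegrE// divr_ge0// exprn_ge0.
have [x2 y2] := (sqr_ge0 x, sqr_ge0 y).
have [xb|xb] := leP (1 / 4 ^+ i / 2) (x ^+ 2).
  rewrite /fejer2 mulrAC ler_pM//; apply: half => //; lra.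
rewrite /fejer2 -mulrA mulrCA ler_pM//; apply: half => //; lra.
Qed.
End layers.

(** * Calculus of integrals of bounded measurable functions *)

Section bounded_measurable.
Context d (T : measurableType d) (R : realType) (mu : {measure set T -> \bar R}).
Variable D : set T.
Hypothesis mD : measurable D.
Hypothesis muD : (mu D < +oo)%E.

(** A class closed under sums and products, whose members are integrable because [D] has finite
    measure. The bound is asked on all of [T], measurability only on [D]. *)
Definition bounded_meas (f : T -> R) :=
  measurable_fun D f /\ exists M : R, forall t, `|f t| <= M.

Lemma bounded_meas_integrable f : bounded_meas f -> mu.-integrable D (EFin \o f).
Proof.
move=> [mf [M fM]]; apply: measurable_bounded_integrable => //.
exists M; split; first exact: num_real.
by move=> x Mx t _; apply: le_trans (fM t) (ltW Mx).
Qed.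

Lemma bounded_meas_cst r : bounded_meas (fun=> r).
Proof. by split; [exact: measurable_cst|exists `|r|]. Qed.

Lemma bounded_measD f g : bounded_meas f -> bounded_meas g ->
  bounded_meas (fun t => f t + g t).
Proof.
move=> [mf [M fM]] [mg [M' gM]]; split; first exact: measurable_funD.
by exists (M + M') => t; apply: le_trans (ler_normD _ _) _; exact: lerD.
Qed.

Lemma bounded_measM f g : bounded_meas f -> bounded_meas g ->
  bounded_meas (fun t => f t * g t).
Proof.
move=> [mf [M fM]] [mg [M' gM]]; split; first exact: measurable_funM.
by exists (M * M') => t; rewrite normrM; exact: ler_pM.
Qed.

Lemma bounded_meas_sum (I : Type) (s : seq I) (F : I -> T -> R) :
  (forall i, bounded_meas (F i)) -> bounded_meas (fun t => \sum_(i <- s) F i t).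
Proof.
move=> bF; elim: s => [|i s IH].
  by under eq_fun do rewrite big_nil; exact: bounded_meas_cst.
by under eq_fun do rewrite big_cons; exact: bounded_measD.
Qed.

Lemma bounded_meas_cos f : measurable_fun D f -> bounded_meas (fun t => cos (f t)).
Proof.
move=> mf; split; last by exists 1 => t; exact: cos_max.
apply: measurableT_comp => //.
by apply: continuous_measurable_fun; exact: continuous_cos.
Qed.

Lemma bounded_meas_sin f : measurable_fun D f -> bounded_meas (fun t => sin (f t)).
Proof.
move=> mf; split; last by exists 1 => t; exact: sin_max.
apply: measurableT_comp => //.
by apply: continuous_measurable_fun; exact: continuous_sin.
Qed.

Local Notation Ex f := (Rintegral mu D f).

Lemma Rintegral_sum (I : Type) (s : seq I) (F : I -> T -> R) :
  (forall i, bounded_meas (F i)) ->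
  \int[mu]_(t in D) (\sum_(i <- s) F i t) = \sum_(i <- s) Ex (F i).
Proof.
move=> bF; elim: s => [|i s IH].
  under eq_Rintegral do rewrite big_nil.
  by rewrite big_nil Rintegral_cst// mul0r.
under eq_Rintegral do rewrite big_cons.
rewrite big_cons -IH RintegralD//; first exact: bounded_meas_integrable.
by apply: bounded_meas_integrable; exact: bounded_meas_sum.
Qed.

Lemma bounded_meas_le f g : bounded_meas f -> bounded_meas g ->
  (forall t, D t -> f t <= g t) -> Ex f <= Ex g.
Proof.
by move=> bf bg fg; apply: le_Rintegral => //; exact: bounded_meas_integrable.
Qed.

Lemma bounded_measD_int f g : bounded_meas f -> bounded_meas g ->
  \int[mu]_(t in D) (f t + g t) = Ex f + Ex g.
Proof. by move=> bf bg; rewrite RintegralD//; exact: bounded_meas_integrable. Qed.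

Lemma bounded_measZ_int f r : bounded_meas f ->
  \int[mu]_(t in D) (r * f t) = r * Ex f.
Proof. by move=> bf; rewrite RintegralZl//; exact: bounded_meas_integrable. Qed.

End bounded_measurable.

(** * Circular averages of Fejer kernels *)

Section fejer_index.
Variable R : realType.

Lemma fejer2_pairE N (x y : R) : fejer2 N x y =
  \sum_(j : ('I_N * 'I_N) * ('I_N * 'I_N))
    cos ((j.1.1%:R - j.2.1%:R) * x + (j.1.2%:R - j.2.2%:R) * y).
Proof.
rewrite fejer2E pair_bigA/=; under eq_bigr do rewrite pair_bigA/=.
by rewrite pair_bigA.
Qed.

End fejer_index.

Section circle.
Variable R : realType.
Notation mu := (@lebesgue_measure R).
Definition circle_dom : set R := [set` `[0, 2 * pi]].
Notation D := circle_dom.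

Lemma measurable_circle_dom : measurable D.
Proof. exact: measurable_itv. Qed.

Lemma circle_dom_measure : mu D = (2 * pi)%:E.
Proof.
by rewrite /circle_dom lebesgue_measure_itv/= lte_fin mulr_gt0 ?pi_gt0// oppr0 adde0.
Qed.

Lemma circle_dom_finite : (mu D < +oo)%E.
Proof. by rewrite circle_dom_measure ltry. Qed.

Variable r : R.
Hypothesis r02 : 0 < r <= 2.

Definition circle_kernel (N : nat) (x y : R) : R :=
  \int[mu]_(t in D) fejer2 N (x - r * cos t) (y - r * sin t).

(** This is [2 pi J_0(r |(u, v)|)], with [J_0] the Bessel function. *)
Definition circle_cos (u v : R) : R :=
  \int[mu]_(t in D) cos (u * r * cos t + v * r * sin t).
Definition circle_sin (u v : R) : R :=
  \int[mu]_(t in D) sin (u * r * cos t + v * r * sin t).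

Let meas_phase (u v : R) : measurable_fun D (fun t => u * r * cos t + v * r * sin t).
Proof.
apply: measurable_funTS; apply: measurable_funD; apply: measurable_funM => //.
  by apply: continuous_measurable_fun; exact: continuous_cos.
by apply: continuous_measurable_fun; exact: continuous_sin.
Qed.

Let bm_cos u v := bounded_meas_cos (meas_phase u v).
Let bm_sin u v := bounded_meas_sin (meas_phase u v).

Lemma circle_kernelE N x y : circle_kernel N x y =
  \sum_(j : ('I_N * 'I_N) * ('I_N * 'I_N))
    (circle_cos (j.1.1%:R - j.2.1%:R) (j.1.2%:R - j.2.2%:R)
       * cos ((j.1.1%:R - j.2.1%:R) * x + (j.1.2%:R - j.2.2%:R) * y)
    + circle_sin (j.1.1%:R - j.2.1%:R) (j.1.2%:R - j.2.2%:R)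
       * sin ((j.1.1%:R - j.2.1%:R) * x + (j.1.2%:R - j.2.2%:R) * y)).
Proof.
rewrite /circle_kernel.
have mD := measurable_circle_dom; have fD := circle_dom_finite.
pose F (j : ('I_N * 'I_N) * ('I_N * 'I_N)) t : R :=
  cos ((j.1.1%:R - j.2.1%:R) * x + (j.1.2%:R - j.2.2%:R) * y) *
  cos ((j.1.1%:R - j.2.1%:R) * r * cos t + (j.1.2%:R - j.2.2%:R) * r * sin t) +
  sin ((j.1.1%:R - j.2.1%:R) * x + (j.1.2%:R - j.2.2%:R) * y) *
  sin ((j.1.1%:R - j.2.1%:R) * r * cos t + (j.1.2%:R - j.2.2%:R) * r * sin t).
transitivity (\int[mu]_(t in D) \sum_j F j t).
  apply: eq_Rintegral => t _; rewrite fejer2_pairE; apply: eq_bigr => j _.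
  rewrite /F -cosB; congr cos; ring.
have bc c f : bounded_meas D f -> bounded_meas D (fun t => c * f t).
  by move=> bf; apply: bounded_measM => //; exact: bounded_meas_cst.
rewrite Rintegral_sum//; last first.
  by move=> j; apply: bounded_measD; exact: bc.
apply: eq_bigr => j _.
rewrite /F bounded_measD_int//; [|exact: bc|exact: bc].
rewrite !bounded_measZ_int//; [|exact: bm_sin|exact: bm_cos].
congr (_ + _); exact: mulrC.
Qed.

Lemma circle_cos_le u v m : (2 ^+ m) ^+ 2 <= u ^+ 2 + v ^+ 2 ->
  circle_cos u v <= (2 * pi + 4) * (2 * pi) / Num.sqrt r * (Num.sqrt 2)^-1 ^+ m.
Proof.
move=> muv; have /andP[r0 _] := r02.
have pi0 := @pi_gt0 R.
have m0 : 0 < (2 : R) ^+ m by rewrite exprn_gt0.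
have uvE : (u * r) ^+ 2 + (v * r) ^+ 2 = r ^+ 2 * (u ^+ 2 + v ^+ 2) by ring.
have uv0 : 0 < u ^+ 2 + v ^+ 2 by apply: lt_le_trans muv; rewrite exprn_gt0.
apply: le_trans (bessel_decay _) _; first by rewrite uvE gt_eqF// mulr_gt0// exprn_gt0.
rewrite -[leRHS]mulrA ler_pM2l; last by rewrite mulr_gt0// ?addr_gt0 ?mulr_gt0.
pose K := Num.sqrt r * Num.sqrt 2 ^+ m.
have K0 : 0 < K by rewrite mulr_gt0 ?exprn_gt0 ?sqrtr_gt0.
have -> : (Num.sqrt r)^-1 * (Num.sqrt 2)^-1 ^+ m = K^-1 by rewrite /K invfM exprVn.
have K2 : K ^+ 2 = r * 2 ^+ m.
  by rewrite /K exprMn sqr_sqrtr ?ltW// -exprM mulnC exprM sqr_sqrtr.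
have KS : K <= Num.sqrt (Num.sqrt ((u * r) ^+ 2 + (v * r) ^+ 2)).
  rewrite -[leLHS](ger0_norm (ltW K0)) -sqrtr_sqr; apply: ler_wsqrtr.
  rewrite -[leLHS](ger0_norm (sqr_ge0 K)) -sqrtr_sqr; apply: ler_wsqrtr.
  by rewrite K2 uvE exprMn ler_pM2l// exprn_gt0.
by rewrite lef_pV2 ?posrE// (lt_le_trans K0).
Qed.

Lemma circle_cos_le_2pi u v : circle_cos u v <= 2 * pi.
Proof.
apply: le_trans (_ : \int[mu]_(t in D) 1 <= _).
  apply: bounded_meas_le => //; [exact: measurable_circle_dom|exact: circle_dom_finite|exact: bm_cos|].
  exact: bounded_meas_cst.
rewrite Rintegral_cst; last exact: measurable_circle_dom.
have := congr1 fine circle_dom_measure => /= <-; rewrite mul1r; exact: lexx.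
Qed.

Let bm_fejer2 N x y : bounded_meas D (fun t => fejer2 N (x - r * cos t) (y - r * sin t)).
Proof.
pose F t : R := \sum_(j : ('I_N * 'I_N) * ('I_N * 'I_N))
    cos ((j.1.1%:R - j.2.1%:R) * (x - r * cos t) + (j.1.2%:R - j.2.2%:R) * (y - r * sin t)).
have <- : F = (fun t => fejer2 N (x - r * cos t) (y - r * sin t)).
  by apply/funext => t; rewrite /F fejer2_pairE.
rewrite /F; apply: bounded_meas_sum => // j; apply: bounded_meas_cos.
  apply: measurable_funTS; apply: measurable_funD; apply: measurable_funM => //.
    apply: measurable_funB => //; apply: measurable_funM => //.
    by apply: continuous_measurable_fun; exact: continuous_cos.
  apply: measurable_funB => //; apply: measurable_funM => //.
  by apply: continuous_measurable_fun; exact: continuous_sin.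
Qed.

Lemma circle_kernel_ge0 N x y : 0 <= circle_kernel N x y.
Proof. by apply: Rintegral_ge0 => t _; exact: fejer2_ge0. Qed.

(** Let [psi] be the polar angle of [(x, y)]. On an arc of angular length [h = 1 / (4 N)] next to
    [psi], both coordinates of the difference are at most [1 / N] in absolute value: half comes from
    [|v - r|] and half from [r h <= 2 h]. Both Fejer factors are then at least [N^2 / 4], and
    [N^4 / 16 * h = N^3 / 64]. *)
Lemma circle_kernel_ge N x y : (0 < N)%N ->
  `|Num.sqrt (x ^+ 2 + y ^+ 2) - r| <= 1 / (2 * N%:R) ->
  N%:R ^+ 3 / 64 <= circle_kernel N x y.
Proof.
move=> N0; set v := Num.sqrt _ => vr; have /andP[r0 r2] := r02.
have pi2 := @pi_ge2 R.
have N1 : 1 <= N%:R :> R by rewrite ler1n.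
have Np : 0 < N%:R :> R by rewrite (lt_le_trans _ N1).
have v0 : 0 <= v by exact: sqrtr_ge0.
have [psi psi2 [xE yE]] : exists2 p : R, 0 <= p <= 2 * pi & v * cos p = x /\ v * sin p = y.
  have v2E : v ^+ 2 = x ^+ 2 + y ^+ 2 by rewrite sqr_sqrtr// addr_ge0 ?sqr_ge0.
  have [vz|vn0] := eqVneq v 0.
    exists 0; first by rewrite lexx; lra.
    move: v2E; rewrite vz expr0n/= !mul0r => /esym/eqP.
    by rewrite paddr_eq0 ?sqr_ge0// !sqrf_eq0 => /andP[/eqP -> /eqP ->].
  have [p p2 [cE sE]] : exists2 p : R, 0 <= p <= 2 * pi & cos p = x / v /\ sin p = y / v.
    by apply: polar_angle; rewrite !expr_div_n -mulrDl -v2E divff// sqrf_eq0.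
  by exists p => //; rewrite cE sE ![v * _]mulrC !divfK.
pose h : R := 1 / (4 * N%:R).
have h0 : 0 < h by rewrite divr_gt0// mulr_gt0.
have h1 : h <= 1 by rewrite ler_pdivrMr ?mulr_gt0//; lra.
(* The arc starts at [psi], or ends there when it would otherwise leave [[0, 2 pi]]. *)
have [a [a0 a2 apsi]] : exists a, [/\ 0 <= a, a + h <= 2 * pi &
    forall t, a <= t <= a + h -> `|psi - t| <= h].
  move/andP: psi2 => [p0 p2].
  have [ph|ph] := leP (psi + h) (2 * pi).
    by exists psi; split => // t /andP[t1 t2]; rewrite ler_norml; lra.
  exists (psi - h); split; [lra|lra|].
  by move=> t /andP[t1 t2]; rewrite ler_norml; lra.
pose I : set R := [set` `[a, a + h]].
have mI : measurable I by exact: measurable_itv.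
have ID : I `<=` D.
  by move=> t; rewrite /I /D/= !in_itv/= => /andP[t1 t2]; apply/andP; split; lra.
have muI : mu I = h%:E.
  rewrite /I lebesgue_measure_itv/= lte_fin ltrDl h0.
  by rewrite -EFinB addrAC subrr add0r.
apply: le_trans (_ : \int[mu]_(t in D) (N%:R ^+ 4 / 16 * \1_I t) <= _).
  rewrite bounded_measZ_int//; first last.
  - split; last first.
      by exists 1 => t; rewrite indicE; case: (_ \in _); rewrite ?normr1 ?normr0.
    by apply: measurable_funTS; exact: measurable_indic.
  - exact: circle_dom_finite.
  - exact: measurable_circle_dom.
  rewrite /Rintegral integral_indic//; last exact: measurable_circle_dom.
  have -> : I `&` D = I by apply/setIidPl.
  have := congr1 fine muI => /= muI'.
  apply: le_trans (_ : N%:R ^+ 4 / 16 * h <= _); last by rewrite -muI'; exact: lexx.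
  by rewrite le_eqVlt; apply/orP; left; apply/eqP; rewrite /h; field; rewrite gt_eqF.
apply: bounded_meas_le; [exact: measurable_circle_dom|exact: circle_dom_finite| |exact: bm_fejer2|].
  apply: bounded_measM; first exact: bounded_meas_cst.
  split; last first.
    by exists 1 => t; rewrite indicE; case: (_ \in _); rewrite ?normr1 ?normr0.
  by apply: measurable_funTS; exact: measurable_indic.
move=> t _; rewrite indicE; have [tI|_] := boolP (t \in I); last first.
  by rewrite mulr0 fejer2_ge0.
rewrite mulr1.
have pt : `|psi - t| <= h by apply: apsi; move: tI; rewrite inE /I/= in_itv.
have near (f : R -> R) : (forall x, `|f x| <= 1) -> (forall x y, `|f x - f y| <= `|x - y|) ->
    N%:R * `|v * f psi - r * f t| <= 1.
  move=> f1 fl.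
  have -> : v * f psi - r * f t = (v - r) * f psi + r * (f psi - f t) by ring.
  have e1 : `|(v - r) * f psi| <= 1 / (2 * N%:R).
    by rewrite normrM; apply: le_trans vr; rewrite ler_piMr.
  have e2 : `|r * (f psi - f t)| <= 2 * h.
    rewrite normrM gtr0_norm//; apply: ler_pM => //; first exact: ltW.
    exact: le_trans (fl _ _) pt.
  have e3 : `|(v - r) * f psi + r * (f psi - f t)| <= 1 / N%:R.
    apply: le_trans (ler_normD _ _) _; apply: le_trans (lerD e1 e2) _.
    by rewrite le_eqVlt; apply/orP; left; apply/eqP; rewrite /h; field; rewrite gt_eqF.
  by rewrite mulrC -ler_pdivlMr.
have -> : N%:R ^+ 4 / 16 = (N%:R ^+ 2 / 4) * (N%:R ^+ 2 / 4) :> R by field.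
rewrite /fejer2 -xE -yE; apply: ler_pM; rewrite ?divr_ge0 ?exprn_ge0//; apply: fejer_ge; apply: near.
- exact: cos_max.
- exact: cos_lipschitz.
- exact: sin_max.
- exact: sin_lipschitz.
Qed.

End circle.

(** * Probability of a thin annulus *)

Section annulus.
Context d (T : measurableType d) (R : realType) (P : probability T R).
Variables V1 V2 : T -> R.
Hypothesis mV1 : measurable_fun setT V1.
Hypothesis mV2 : measurable_fun setT V2.
Hypothesis V4 : forall t, V1 t ^+ 2 + V2 t ^+ 2 < 4.
Local Notation bm := (@bounded_meas _ T R setT).
Let V t : R := Num.sqrt (V1 t ^+ 2 + V2 t ^+ 2).

Definition char_cos (u v : R) : R := \int[P]_t cos (u * V1 t + v * V2 t).

Hypothesis char_cos_ge0 : forall u v, 0 <= char_cos u v.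
Hypothesis char_sin0 : forall u v, \int[P]_t sin (u * V1 t + v * V2 t) = 0.
Variables b U : R.
Hypothesis b14 : 1 < b <= 4.
Hypothesis U1 : 1 <= U.
Hypothesis layersU : forall m, \int[P]_t layers b m (V t) <= U.

Let PT : (P setT < +oo)%E.
Proof. by rewrite probability_setT ltry. Qed.

Let m_phase u v : measurable_fun setT (fun t => u * V1 t + v * V2 t).
Proof. by apply: measurable_funD; apply: measurable_funM. Qed.
Let bm_cos u v := bounded_meas_cos (m_phase u v).
Let bm_sin u v := bounded_meas_sin (m_phase u v).

Let bm_ind (A : set T) : measurable A -> bm (\1_A).
Proof.
move=> mA; split; first exact: measurable_indic.
by exists 1 => t; rewrite indicE; case: (_ \in _); rewrite ?normr1 ?normr0.
Qed.

Lemma measurable_mod : measurable_fun setT V.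
Proof.
apply: measurableT_comp; first exact: continuous_measurable_fun (@sqrt_continuous R).
by apply: measurable_funD; apply: measurable_funX.
Qed.

Lemma bounded_meas_layers m : bm (fun t => layers b m (V t)).
Proof.
apply: bounded_meas_sum => // i; apply: bounded_measM; first exact: bounded_meas_cst.
have -> : (fun t => (V t < 2 / 2 ^+ i)%R%:R) = \1_(V @^-1` [set` `]-oo, (2 / 2 ^+ i)[]) :> (T -> R).
  by apply/funext => t; rewrite indicE; congr (nat_of_bool _)%:R; apply/idP/idP; rewrite inE/= in_itv.
apply: bm_ind; rewrite -[_ @^-1` _]setTI; apply: measurable_mod => //.
Qed.

Lemma Rintegral_fejer2 N : \int[P]_t fejer2 N (V1 t) (V2 t) =
  \sum_(j : ('I_N * 'I_N) * ('I_N * 'I_N))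
    char_cos (j.1.1%:R - j.2.1%:R) (j.1.2%:R - j.2.2%:R).
Proof.
under eq_Rintegral do rewrite fejer2_pairE.
by rewrite Rintegral_sum.
Qed.

Let bm_fejer2 N : bm (fun t => fejer2 N (V1 t) (V2 t)).
Proof.
pose F t : R := \sum_(j : ('I_N * 'I_N) * ('I_N * 'I_N))
    cos ((j.1.1%:R - j.2.1%:R) * V1 t + (j.1.2%:R - j.2.2%:R) * V2 t).
have <- : F = (fun t => fejer2 N (V1 t) (V2 t)).
  by apply/funext => t; rewrite /F fejer2_pairE.
by rewrite /F; apply: bounded_meas_sum.
Qed.

(** With [M = 2^j], each frequency of the box occurs at least [M^2] times in the mean of the Fejer
    kernel of order [4 M = 2^(j + 2)], and the other terms are nonnegative. For [b = 2^beta] the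
    factor [(4 / b)^j] is [M^(2 - beta)]; [(16 / b)^2] pays for the two extra doublings. *)
Lemma box_sum_char_cos_le j :
  box_sum char_cos (2 ^ j) <= 32 * (16 / b) ^+ 2 * (4 / b) ^+ j * U.
Proof.
have /andP[b1 b4] := b14; have b0 : 0 < b by lra.
have j0 : 0 < (4 : R) ^+ j by rewrite exprn_gt0.
have := box_sum_le char_cos_ge0 (2 ^ j).
have -> : (4 * 2 ^ j = 2 ^ j.+2)%N by rewrite !expnS mulnA.
have -> : \sum_(k1 < 2 ^ j.+2) \sum_(k2 < 2 ^ j.+2) \sum_(l1 < 2 ^ j.+2) \sum_(l2 < 2 ^ j.+2)
    char_cos (k1%:R - l1%:R) (k2%:R - l2%:R) = \int[P]_t fejer2 (2 ^ j.+2) (V1 t) (V2 t).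
  rewrite Rintegral_fejer2 pair_bigA/=; under eq_bigr do rewrite pair_bigA/=.
  by rewrite pair_bigA.
have : \int[P]_t fejer2 (2 ^ j.+2) (V1 t) (V2 t) <= 32 * (16 / b) ^+ j.+2 * U.
  apply: le_trans (_ : \int[P]_t (32 * (16 / b) ^+ j.+2 * layers b j.+2 (V t)) <= _).
    apply: bounded_meas_le => //.
      by apply: bounded_measM; [exact: bounded_meas_cst|exact: bounded_meas_layers].
    by move=> t _; apply: fejer2_le_layers => //; rewrite b0.
  rewrite bounded_measZ_int//; last exact: bounded_meas_layers.
  by rewrite ler_wpM2l// mulr_ge0// exprn_ge0// divr_ge0// ltW.
move=> h1 h2; have {h1 h2} := le_trans h2 h1.
have -> : (2 ^ j)%N%:R ^+ 2 = 4 ^+ j :> R.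
  by rewrite natrX -exprM mulnC exprM; congr (_ ^+ _); rewrite expr2; lra.
have -> : 32 * (16 / b) ^+ j.+2 * U = 4 ^+ j * (32 * (16 / b) ^+ 2 * (4 / b) ^+ j * U).
  rewrite -[j.+2]addn2 exprD; have -> : 16 / b = 4 * (4 / b) by field; rewrite gt_eqF.
  by rewrite [(4 * (4 / b)) ^+ j]exprMn; ring.
by rewrite ler_pM2l.
Qed.

Variable r : R.
Hypothesis r02 : 0 < r <= 2.

Let bm_kernel N : bm (fun t => circle_kernel r N (V1 t) (V2 t)).
Proof.
under eq_fun do rewrite circle_kernelE.
apply: bounded_meas_sum => // j; apply: bounded_measD; apply: bounded_measM => //;
  exact: bounded_meas_cst.
Qed.

Lemma Rintegral_circle_kernel N : \int[P]_t circle_kernel r N (V1 t) (V2 t) =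
  \sum_(j : ('I_N * 'I_N) * ('I_N * 'I_N))
    circle_cos r (j.1.1%:R - j.2.1%:R) (j.1.2%:R - j.2.2%:R)
    * char_cos (j.1.1%:R - j.2.1%:R) (j.1.2%:R - j.2.2%:R).
Proof.
under eq_Rintegral do rewrite circle_kernelE.
rewrite Rintegral_sum//; last first.
  by move=> j; apply: bounded_measD; apply: bounded_measM => //; exact: bounded_meas_cst.
apply: eq_bigr => j _; rewrite bounded_measD_int//; first last.
- by apply: bounded_measM => //; exact: bounded_meas_cst.
- by apply: bounded_measM => //; exact: bounded_meas_cst.
by rewrite !bounded_measZ_int// char_sin0 mulr0 addr0.
Qed.

Let c0 : R := (2 * pi + 4) * (2 * pi) / Num.sqrt r.
Let c0_ge0 : 0 <= c0.
Proof.
have := @pi_ge0 R => pi0.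
by rewrite divr_ge0 ?sqrtr_ge0// mulr_ge0 ?addr_ge0 ?mulr_ge0.
Qed.

Definition near_index (M k l : nat) := (k < l + M)%N && (l < k + M)%N.

Lemma char_cos_le1 u v : char_cos u v <= 1.
Proof.
apply: le_trans (_ : \int[P]_t 1 <= _).
  by apply: bounded_meas_le => //; exact: bounded_meas_cst.
by rewrite Rintegral_cst// mul1r; have /= -> := congr1 fine (probability_setT P).
Qed.

(* Dyadic decomposition according to the size of the frequency [k - l]. *)
Lemma circle_cos_char_cos_le nu (k1 k2 l1 l2 : nat) :
  (k1 < 2 ^ nu)%N -> (k2 < 2 ^ nu)%N -> (l1 < 2 ^ nu)%N -> (l2 < 2 ^ nu)%N ->
  circle_cos r (k1%:R - l1%:R) (k2%:R - l2%:R) * char_cos (k1%:R - l1%:R) (k2%:R - l2%:R)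
  <= 2 * pi * ((k1 == l1) && (k2 == l2))%:R +
     \sum_(m < nu) c0 * (Num.sqrt 2)^-1 ^+ m *
       ((near_index (2 ^ m.+1) k1 l1 && near_index (2 ^ m.+1) k2 l2)%:R *
        char_cos (k1%:R - l1%:R) (k2%:R - l2%:R)).
Proof.
move=> k1n k2n l1n l2n.
set u := k1%:R - l1%:R; set v := k2%:R - l2%:R.
have term_ge0 m : 0 <= c0 * (Num.sqrt 2)^-1 ^+ m *
    ((near_index (2 ^ m.+1) k1 l1 && near_index (2 ^ m.+1) k2 l2)%:R * char_cos u v).
  apply: mulr_ge0; last exact: mulr_ge0.
  by apply: mulr_ge0 => //; rewrite exprn_ge0// invr_ge0 sqrtr_ge0.
have [/andP[/eqP e1 /eqP e2]|ne] := boolP ((k1 == l1) && (k2 == l2)).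
  rewrite mulr1; apply: le_trans (_ : 2 * pi <= _); last by rewrite lerDl sumr_ge0.
  have := char_cos_le1 u v; have := char_cos_ge0 u v; have := circle_cos_le_2pi r u v.
  have := @pi_ge0 R; nra.
rewrite mulr0 add0r.
(* The maximum norm of the frequency: of two opposite truncated differences at least one is zero.
   Below, [2^m <= M] yields the decay of [circle_cos] and [M < 2^(m + 1)] the membership in the
   window. *)
pose M := maxn (maxn (k1 - l1) (l1 - k1)) (maxn (k2 - l2) (l2 - k2)).
have M0 : (0 < M)%N.
  rewrite lt0n; apply: contra ne; rewrite /M -leqn0 !geq_max !leqn0 !subn_eq0.
  by move=> /andP[/andP[a1 a2] /andP[a3 a4]]; rewrite !eqn_leq a1 a2 a3 a4.
have Mn : (M < 2 ^ nu)%N by rewrite /M !gtn_max !(leq_ltn_trans (leq_subr _ _)).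
pose m := trunc_log 2 M.
have /andP[mM Mm] : (2 ^ m <= M < 2 ^ m.+1)%N by exact: trunc_log_bounds.
have mnu : (m < nu)%N by rewrite -(@ltn_exp2l 2)//; exact: leq_ltn_trans mM Mn.
rewrite (bigD1 (Ordinal mnu))//=.
have -> : near_index (2 ^ m.+1) k1 l1 && near_index (2 ^ m.+1) k2 l2.
  move: Mm; rewrite /M !gtn_max /near_index => /andP[/andP[a1 a2] /andP[a3 a4]].
  by move: a1 a2 a3 a4; rewrite !ltn_psubLR ?expn_gt0// => -> -> -> ->.
rewrite mul1r -[leLHS]addr0; apply: lerD; last by apply: sumr_ge0.
rewrite ler_wpM2r//; apply: circle_cos_le => //.
have sq (a c : nat) : (2 ^ m <= maxn (a - c) (c - a))%N ->
    (2 ^+ m) ^+ 2 <= (a%:R - c%:R) ^+ 2 :> R.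
  rewrite leq_max => h; rewrite -[leRHS]real_normK ?num_real//.
  rewrite ler_pXn2r ?nnegrE ?exprn_ge0// -natrX.
  case/orP: h => h.
    have ca : (c <= a)%N by rewrite leqNgt; apply/negP => /ltnW; rewrite -subn_eq0 => /eqP e; move: h; rewrite e leqNgt expn_gt0.
    by rewrite -natrB// normr_nat ler_nat.
  have ca : (a <= c)%N by rewrite leqNgt; apply/negP => /ltnW; rewrite -subn_eq0 => /eqP e; move: h; rewrite e leqNgt expn_gt0.
  by rewrite distrC -natrB// normr_nat ler_nat.
have [u2 v2] := (sqr_ge0 u, sqr_ge0 v).
by move: mM; rewrite /M leq_max => /orP[] /sq; rewrite -/u -/v; lra.
Qed.

Let sum_near_le N M : \sum_(j : ('I_N * 'I_N) * ('I_N * 'I_N))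
    (near_index M j.1.1 j.2.1 && near_index M j.1.2 j.2.2)%:R
     * char_cos (j.1.1%:R - j.2.1%:R) (j.1.2%:R - j.2.2%:R)
  <= N%:R ^+ 2 * box_sum char_cos M.
Proof.
rewrite -(pair_bigA _ (fun k l : 'I_N * 'I_N =>
  (near_index M k.1 l.1 && near_index M k.2 l.2)%:R
     * char_cos (k.1%:R - l.1%:R) (k.2%:R - l.2%:R)))/= exchange_big/=.
apply: le_trans (_ : \sum_(l : 'I_N * 'I_N) box_sum char_cos M <= _); last first.
  by rewrite sumr_const card_prod card_ord -[leLHS]mulr_natl natrM expr2.
apply: ler_sum => -[l1 l2] _ /=.
rewrite -(pair_bigA _ (fun k1 k2 : 'I_N => (near_index M k1 l1 && near_index M k2 l2)%:R
     * char_cos (k1%:R - l1%:R) (k2%:R - l2%:R)))/=.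
apply: le_trans (box_sum_window char_cos_ge0 N M l1 l2).
rewrite [leRHS]big_mkcond; apply: ler_sum => k1 _.
rewrite /near_index; case: ifP => _ /=; last by rewrite big1// => k2 _; rewrite mul0r.
rewrite [leRHS]big_mkcond; apply: ler_sum => k2 _.
by case: ifP => _; rewrite ?mul1r ?mul0r.
Qed.

Let sum_diag N : \sum_(j : ('I_N * 'I_N) * ('I_N * 'I_N))
    ((j.1.1 == j.2.1 :> nat) && (j.1.2 == j.2.2 :> nat))%:R = N%:R ^+ 2 :> R.
Proof.
rewrite -(pair_bigA _ (fun k l : 'I_N * 'I_N =>
  ((k.1 == l.1 :> nat) && (k.2 == l.2 :> nat))%:R : R))/=.
transitivity (\sum_(k : 'I_N * 'I_N) (1 : R)).
  apply: eq_bigr => k _; rewrite (bigD1 k)//= !eqxx big1 ?addr0// => l lk.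
  by rewrite !val_eqE -xpair_eqE -!surjective_pairing eq_sym (negbTE lk).
by rewrite sumr_const card_prod card_ord natrM expr2.
Qed.

(** In each shell, fixing [l] leaves at most one box sum, and there are [N^2] choices of [l]. The
    decay [2^(-m/2)] times the box sum of size [2^(m + 1)] produces a geometric sum of ratio
    [2^(3/2 - beta)] when [b = 2^beta]. *)
Lemma Rintegral_circle_kernel_le nu :
  \int[P]_t circle_kernel r (2 ^ nu) (V1 t) (V2 t) <=
  (2 ^ nu)%:R ^+ 2 * (2 * pi + c0 * (32 * (16 / b) ^+ 2 * (4 / b) * U)
    * \sum_(m < nu) ((Num.sqrt 2)^-1 * (4 / b)) ^+ m).
Proof.
rewrite Rintegral_circle_kernel.
apply: le_trans (ler_sum _ (fun j _ => circle_cos_char_cos_le (ltn_ord j.1.1)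
  (ltn_ord j.1.2) (ltn_ord j.2.1) (ltn_ord j.2.2))) _.
rewrite big_split/= -mulr_sumr sum_diag [leRHS]mulrDr; apply: lerD; first by rewrite mulrC.
rewrite exchange_big/= mulrA mulr_sumr; apply: ler_sum => m _.
rewrite -mulr_sumr.
apply: le_trans (_ : c0 * (Num.sqrt 2)^-1 ^+ m *
    ((2 ^ nu)%:R ^+ 2 * (32 * (16 / b) ^+ 2 * (4 / b) ^+ m.+1 * U)) <= _).
  apply: ler_wpM2l; first by rewrite mulr_ge0// exprn_ge0// invr_ge0 sqrtr_ge0.
  apply: le_trans (sum_near_le _ _) _.
  by apply: ler_wpM2l; [rewrite exprn_ge0|exact: box_sum_char_cos_le].
by rewrite le_eqVlt; apply/orP; left; apply/eqP; rewrite [(_ * (4 / b)) ^+ m]exprMn [_ ^+ m.+1]exprS; ring.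
Qed.

Hypothesis b28 : b ^+ 2 < 8.

(** The factor 64 inverts the one in [circle_kernel_ge]. The denominator is [c - 1] for the ratio
    [c] of the geometric sum, and [c > 1] because [b^2 < 8]. Doubling the diagonal term to [4 * pi]
    lets it be absorbed into [U / Num.sqrt r], as [Num.sqrt r <= 2]. *)
Definition annulus_const (b : R) : R :=
  64 * (4 * pi + (2 * pi + 4) * (2 * pi) * (32 * (16 / b) ^+ 2 * (4 / b))
    / ((Num.sqrt 2)^-1 * (4 / b) - 1)).

(** Markov's inequality for the circle kernel: it is at least [N^3 / 64] on [A], and its mean is of
    order [N^2 c^nu]. Since [c / 2 = Num.sqrt 2 / b], the quotient [c^nu / N] is the last factor,
    which for [b = 2^beta] is [N^(1/2 - beta)]. *)
Lemma annulus_prob_le nu (A : set T) : measurable A ->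
  (forall t, A t -> `|V t - r| <= 1 / (2 * (2 ^ nu)%:R)) ->
  fine (P A) <= annulus_const b * U / Num.sqrt r * (Num.sqrt 2 / b) ^+ nu.
Proof.
move=> mA Ar.
have /andP[b1 b4] := b14; have b0 : 0 < b by lra.
have /andP[r0 r2] := r02.
have pi0 := @pi_gt0 R.
set N := (2 ^ nu)%N; have N0 : (0 < N)%N by rewrite expn_gt0.
have Np : 0 < N%:R :> R by rewrite ltr0n.
have s0 : 0 < Num.sqrt 2 :> R by rewrite sqrtr_gt0.
have s2 : Num.sqrt 2 ^+ 2 = 2 :> R by rewrite sqr_sqrtr.
set s := Num.sqrt 2 in s0 s2 *.
set c := s^-1 * (4 / b).
have c1 : 1 < c.
  have sb : s * b < 4.
    rewrite -(@ltr_pXn2r _ 2) ?nnegrE ?mulr_ge0 ?(ltW s0) ?(ltW b0)// exprMn s2.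
    by apply: lt_le_trans (_ : 2 * 8 <= _); [rewrite ltr_pM2l|lra].
  by rewrite /c mulrCA -invfM ltr_pdivlMr ?mulr_gt0// mul1r.
have cn1 : 1 <= c ^+ nu by rewrite exprn_ege1// ltW.
have lower : fine (P A) * (N%:R ^+ 3 / 64) <= \int[P]_t circle_kernel r N (V1 t) (V2 t).
  apply: le_trans (_ : \int[P]_t (N%:R ^+ 3 / 64 * \1_A t) <= _).
    rewrite bounded_measZ_int//; last exact: bm_ind.
    by rewrite /Rintegral integral_indic// setIT mulrC.
  apply: bounded_meas_le => //.
    by apply: bounded_measM; [exact: bounded_meas_cst|exact: bm_ind].
  move=> t _; rewrite indicE; have [tA|_] := boolP (t \in A); last first.
    by rewrite mulr0 circle_kernel_ge0.
  by rewrite mulr1; apply: circle_kernel_ge => //; apply: Ar; rewrite inE in tA.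
have := le_trans lower (Rintegral_circle_kernel_le nu).
rewrite -/N -/s -/c; set S := \sum_(m < nu) c ^+ m.
have SE : S <= c ^+ nu / (c - 1).
  by rewrite ler_pdivlMr ?subr_gt0// mulrC -subrX1 lerBlDr lerDl.
have sr0 : 0 < Num.sqrt r by rewrite sqrtr_gt0.
have sr2 : Num.sqrt r <= 2.
  rewrite -(@ler_pXn2r _ 2) ?nnegrE ?(ltW sr0)// sqr_sqrtr ?(ltW r0)//.
  by apply: le_trans r2 _; lra.
set B1 := 32 * (16 / b) ^+ 2 * (4 / b).
have B10 : 0 <= B1.
  by rewrite /B1 mulr_ge0 ?divr_ge0 ?(ltW b0)// mulr_ge0// exprn_ge0// divr_ge0// ltW.
move=> h.
have bnd : 2 * pi + c0 * (B1 * U) * S <=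
    annulus_const b / 64 * (U / Num.sqrt r * c ^+ nu).
  rewrite /annulus_const -/s -/c -/B1.
  have -> : 64 * (4 * pi + (2 * pi + 4) * (2 * pi) * B1 / (c - 1)) / 64 *
     (U / Num.sqrt r * c ^+ nu) = 2 * pi * (2 / Num.sqrt r * (U * c ^+ nu))
     + c0 * (B1 * U) * (c ^+ nu / (c - 1)).
    by rewrite /c0; field; rewrite subr_eq0 !gt_eqF.
  apply: lerD.
    rewrite ler_peMr ?mulr_ge0 ?(ltW pi0)//.
    apply: mulr_ege1; first by rewrite ler_pdivlMr// mul1r.
    exact: mulr_ege1.
  apply: ler_wpM2l => //; apply: mulr_ge0 => //; apply: mulr_ge0 => //.
  exact: le_trans U1.
have : fine (P A) * (N%:R ^+ 3 / 64) <= N%:R ^+ 2 * (annulus_const b / 64 * (U / Num.sqrt r * c ^+ nu)).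
  by apply: le_trans h _; rewrite ler_pM2l ?exprn_gt0.
rewrite -ler_pdivlMr ?divr_gt0 ?exprn_gt0// => /le_trans; apply.
rewrite le_eqVlt; apply/orP; left; apply/eqP.
have -> : s / b = c / 2.
  have e : s = 2 / s by rewrite -s2 expr2 mulfK// gt_eqF.
  by rewrite /c [in LHS]e; field; rewrite !gt_eqF.
have NE : N%:R = 2 ^+ nu :> R by rewrite /N natrX.
rewrite expr_div_n -NE; field.
by rewrite !gt_eqF.
Qed.

End annulus.

(** * Independent copies *)

Section independence.
Context d d' (T : measurableType d) (T' : measurableType d') (R : realType)
  (P : probability T R).
Variables X Y : {mfun T >-> T'}.
Hypothesis indep : forall A B : set T', measurable A -> measurable B ->
  P (X @^-1` A `&` Y @^-1` B) = (P (X @^-1` A) * P (Y @^-1` B))%E.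

Let Zf t := (X t, Y t).
Let mZ : measurable_fun setT Zf.
Proof. by apply: measurable_fun_pair. Qed.
HB.instance Definition _ := isMeasurableFun.Build _ _ _ _ Zf mZ.
Let Z : {mfun T >-> (T' * T')%type} := Zf.
Local Notation m1 := (distribution P X).
Local Notation m2 := (distribution P Y).

(** Independence only speaks of rectangles, but these determine the product measure; it thereby
    reaches sets such as the pairs of points at distance less than [rho]. *)
Lemma distribution_pair (A : set (T' * T')) : measurable A ->
  distribution P Z A = (m1 \x m2)%E A.
Proof.
move=> mA; apply/esym; apply: product_measure_unique => // B C mB mC; exact: indep.
Qed.

Lemma Rintegral_indep (f g : T' -> R) : bounded_meas setT f -> bounded_meas setT g ->
  \int[P]_t (f (X t) * g (Y t)) = (\int[P]_t f (X t)) * \int[P]_t g (Y t).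
Proof.
move=> bf bg.
have [[mf [M fM]] [mg [M' gM]]] := (bf, bg).
have PT : (P setT < +oo)%E by rewrite probability_setT ltry.
have m1T : (m1 setT < +oo)%E by rewrite probability_setT ltry.
have m2T : (m2 setT < +oo)%E by rewrite probability_setT ltry.
pose h z : R := f z.1 * g z.2.
have mh : measurable_fun setT h by apply: measurable_funM; apply: measurableT_comp.
have bh : bounded_meas setT h.
  by split=> //; exists (M * M') => z; rewrite normrM ler_pM.
have dT : ((distribution P Z) setT < +oo)%E by rewrite probability_setT ltry.
have m12T : ((m1 \x m2)%E setT < +oo)%E.
  have -> : (m1 \x m2)%E setT = 1%E; last exact: ltry.
  by transitivity (distribution P Z setT); [exact/esym/distribution_pair|exact: probability_setT].
have bfX : bounded_meas setT (f \o X) by split; [exact: measurableT_comp|exists M => t; exact: fM].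
have bgY : bounded_meas setT (g \o Y) by split; [exact: measurableT_comp|exists M' => t; exact: gM].
have e1 : (\int[P]_t (f (X t) * g (Y t))%:E = \int[m1 \x m2]_z (h z)%:E)%E.
  rewrite -(@eq_measure_integral _ _ _ _ _ (distribution P Z)); last first.
    by move=> A mA _; first [exact: distribution_pair|exact/esym/distribution_pair].
  rewrite integral_distribution//; first exact/measurable_EFinP.
  have -> : (EFin \o h) \o Z = EFin \o (fun t => (f \o X) t * (g \o Y) t) by [].
  by apply: bounded_meas_integrable => //; exact: bounded_measM.
have eX : \int[P]_t f (X t) = \int[m1]_x f x.
  rewrite /Rintegral integral_distribution//; first exact/measurable_EFinP.
  exact: (bounded_meas_integrable measurableT PT bfX).
have eY : \int[P]_t g (Y t) = \int[m2]_x g x.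
  rewrite /Rintegral integral_distribution//; first exact/measurable_EFinP.
  exact: (bounded_meas_integrable measurableT PT bgY).
rewrite eX eY mulrC -RintegralZl//; last exact: bounded_meas_integrable.
rewrite /Rintegral e1 -integral12_prod_meas1; last exact: bounded_meas_integrable.
congr fine; apply: eq_integral => x _ /=.
rewrite /fubini_F/= /h/=; under eq_integral do rewrite EFinM.
rewrite integralZl//; last exact: bounded_meas_integrable.
rewrite mulrC EFinM fineK//; apply: integrable_fin_num => //.
exact: bounded_meas_integrable.
Qed.

End independence.

(** * Characteristic function and Frostman bound of the difference *)

Section iid.
Context d (T : measurableType d) (R : realType) (P : probability T R).
Variables (C s2 : R) (W W' : T -> R * R).
Hypothesis mW : measurable_fun setT W.
Hypothesis mW' : measurable_fun setT W'.
Hypothesis frost : frostman P W s2 C.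
Hypothesis indep : independent2 P W W'.
Hypothesis same : same_distr P W W'.

HB.instance Definition _ := isMeasurableFun.Build _ _ _ _ W mW.
HB.instance Definition _ := isMeasurableFun.Build _ _ _ _ W' mW'.

Let X : {mfun T >-> (R * R)%type} := W.
Let Y : {mfun T >-> (R * R)%type} := W'.

Lemma Rintegral_same_distr (f : R * R -> R) : bounded_meas setT f ->
  \int[P]_t f (W' t) = \int[P]_t f (W t).
Proof.
move=> bf; have [mf [M fM]] := bf.
have PT : (P setT < +oo)%E by rewrite probability_setT ltry.
have e (Q : {mfun T >-> (R * R)%type}) : \int[P]_t f (Q t) = \int[distribution P Q]_x f x.
  rewrite /Rintegral integral_distribution//; first exact/measurable_EFinP.
  apply: (bounded_meas_integrable measurableT PT (f := f \o Q)).
  by split; [exact: measurableT_comp|exists M => t; exact: fM].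
rewrite (e Y) (e X) /Rintegral; congr fine; apply: eq_measure_integral => A mA _.
exact/esym/same.
Qed.

Let phase u v (x : R * R) : R := u * x.1 + v * x.2.
Let m_phase u v : measurable_fun setT (phase u v).
Proof. by apply: measurable_funD; apply: measurable_funM. Qed.
Let bc u v := bounded_meas_cos (m_phase u v).
Let bs u v := bounded_meas_sin (m_phase u v).
Let PT : (P setT < +oo)%E.
Proof. by rewrite probability_setT ltry. Qed.

Let bQ (Q : {mfun T >-> (R * R)%type}) f : bounded_meas setT f ->
  @bounded_meas _ T R setT (fun t => f (Q t)).
Proof. by move=> [mf [M fM]]; split; [exact: measurableT_comp|exists M => t; exact: fM]. Qed.

Lemma char_cos_diff u v :
  \int[P]_t cos (u * ((W t).1 - (W' t).1) + v * ((W t).2 - (W' t).2)) =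
  (\int[P]_t cos (phase u v (W t))) ^+ 2 + (\int[P]_t sin (phase u v (W t))) ^+ 2.
Proof.
transitivity (\int[P]_t (cos (phase u v (X t)) * cos (phase u v (Y t))
   + sin (phase u v (X t)) * sin (phase u v (Y t)))).
  by apply: eq_Rintegral => t _; rewrite -cosB /phase; congr cos; rewrite /=; ring.
rewrite bounded_measD_int//; first last.
- by apply: bounded_measM; apply: (bQ _ (bs u v)).
- by apply: bounded_measM; apply: (bQ _ (bc u v)).
rewrite (Rintegral_indep (X := X) (Y := Y) indep (bc u v) (bc u v)).
rewrite (Rintegral_indep (X := X) (Y := Y) indep (bs u v) (bs u v)).
by rewrite (Rintegral_same_distr (bc u v)) (Rintegral_same_distr (bs u v)) !expr2.
Qed.

Lemma char_sin_diff u v :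
  \int[P]_t sin (u * ((W t).1 - (W' t).1) + v * ((W t).2 - (W' t).2)) = 0.
Proof.
transitivity (\int[P]_t (sin (phase u v (X t)) * cos (phase u v (Y t))
   + (-1) * (cos (phase u v (X t)) * sin (phase u v (Y t))))).
  by apply: eq_Rintegral => t _; rewrite mulN1r -sinB /phase; congr sin; rewrite /=; ring.
have bcs : @bounded_meas _ T R setT (fun t => cos (phase u v (X t)) * sin (phase u v (Y t))).
  by apply: bounded_measM; [apply: (bQ _ (bc u v))|apply: (bQ _ (bs u v))].
rewrite bounded_measD_int//; first last.
- by apply: bounded_measM => //; exact: bounded_meas_cst.
- by apply: bounded_measM; [apply: (bQ _ (bs u v))|apply: (bQ _ (bc u v))].
rewrite bounded_measZ_int//.
rewrite (Rintegral_indep (X := X) (Y := Y) indep (bs u v) (bc u v)).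
rewrite (Rintegral_indep (X := X) (Y := Y) indep (bc u v) (bs u v)).
by rewrite (Rintegral_same_distr (bc u v)) (Rintegral_same_distr (bs u v)); ring.
Qed.

(** Given [W = x], the event says that [W'] lies in the ball of radius [rho] about [x]. The Frostman
    condition, carried from [W] to [W'] by [same], bounds this uniformly in [x], and Fubini
    concludes. *)
Lemma frostman_diff (rho : R) : 0 < rho ->
  (P [set t | (Num.sqrt (((W t).1 - (W' t).1) ^+ 2 + ((W t).2 - (W' t).2) ^+ 2) < rho)%R]
    <= (C * rho `^ s2)%:E)%E.
Proof.
move=> rho0.
pose N (z : (R * R) * (R * R)) : R := norm2 (z.2.1 - z.1.1, z.2.2 - z.1.2).
have mN : measurable_fun setT N.
  rewrite /N /norm2/=.
  apply: measurableT_comp; first exact: continuous_measurable_fun (@sqrt_continuous R).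
  apply: measurable_funD; apply: measurable_funX; apply: measurable_funB;
    exact: measurableT_comp.
pose A : set ((R * R) * (R * R)) := N @^-1` [set` `]-oo, rho[].
have mA : measurable A by rewrite /A -[_ @^-1` _]setTI; apply: mN.
have mball x : measurable (ball2 x rho).
  have -> : ball2 x rho = xsection A x.
    by apply/seteqP; split => y; rewrite /ball2 /xsection/= inE /A/= in_itv.
  exact: measurable_xsection.
have -> : [set t | Num.sqrt (((W t).1 - (W' t).1) ^+ 2 + ((W t).2 - (W' t).2) ^+ 2) < rho]
    = (fun t => (X t, Y t)) @^-1` A.
  apply/seteqP; split => t; rewrite /= /A/= in_itv/= /N /norm2/=;
  by rewrite -sqrrN opprB -[X in _ + X]sqrrN opprB.
have /= e := distribution_pair (X := X) (Y := Y) indep mA.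
apply: le_trans (_ : (distribution P X \x distribution P Y)%E A <= _)%E; first by rewrite -e.
rewrite /product_measure1/=.
apply: le_trans (_ : (\int[distribution P X]_x (C * rho `^ s2)%:E <= _)%E).
  apply: ge0_le_integral => //.
  - exact: (measurable_fun_xsection (distribution P Y) mA).
  - move=> x _ /=.
    have -> : xsection A x = ball2 x rho.
      by apply/seteqP; split => y; rewrite /ball2 /xsection/= inE /A/= in_itv.
    rewrite /distribution /pushforward /Y/= -same//; exact: frost.
have XT : distribution P X setT = 1%E by exact: probability_setT.
by rewrite integral_cst// [X in (_ * X)%E](_ : _ = 1%E)// mule1.
Qed.
End iid.

(** * Entropy and energy *)

Section entropy_bound.
Context d (T : measurableType d) (R : realType) (P : probability T R).

Lemma fine_prob_ge0 (A : set T) : 0 <= fine (P A).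
Proof. exact/fine_ge0/measure_ge0. Qed.

(** The convex function [- ln] lies above its tangent at [S]; the inequality is multiplied by
    [p]. *)
Lemma ln_ge_tangent (p S : R) : 0 <= p -> 0 < S -> p * (1 - ln S) - p ^+ 2 / S <= - (p * ln p).
Proof.
move=> p0 S0; have [->|pn0] := eqVneq p 0; first by rewrite expr0n/= !mul0r subr0 oppr0.
have pp : 0 < p by rewrite lt_neqAle eq_sym pn0.
have h : ln (p / S) <= p / S - 1.
  have := @le_ln1Dx R (p / S - 1); rewrite addrCA subrr addr0; apply.
  by rewrite ltrBDl subrr divr_gt0.
rewrite ln_div ?posrE// in h.
have -> : p * (1 - ln S) - p ^+ 2 / S = - (p * (p / S - 1 + ln S)) by ring.
by rewrite lerN2 ler_pM2l//; lra.
Qed.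

(** Jensen's inequality through a single tangent: as the masses sum to 1, [ln_ge_tangent] adds up to
    [1 - ln S - (sum p^2) / S >= - ln S], for any upper bound [S] of the collision probability. *)
Lemma entropy_ge_collision (X : T -> R) (f : nat -> R) (M : nat) (S : R) :
  injective f -> (forall t, exists2 k, (k < M)%N & X t = f k) ->
  (forall k, measurable (X @^-1` [set f k])) -> 0 < S ->
  \sum_(k < M) fine (P (X @^-1` [set f k])) ^+ 2 <= S ->
  ((- log2 S)%:E <= entropy P X)%E.
Proof.
move=> finj Xf mX S0 pS.
pose p k := fine (P (X @^-1` [set f k])).
have sum_p : \sum_(k < M) p k = 1.
  have -> : \sum_(k < M) p k = fine (\sum_(k < M) P (X @^-1` [set f k]))%E.
    by rewrite -sum_fine// => k _; exact: fin_num_measure.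
  rewrite -(@measure_semi_additive_ord_I _ _ _ P (fun k => X @^-1` [set f k]))//; last 2 first.
  - by move=> i j _ _ [t [/= -> /finj]].
  - exact: bigsetU_measurable.
  have -> : \big[setU/set0]_(k < M) X @^-1` [set f k] = setT.
    rewrite -(bigcup_mkord M (fun k => X @^-1` [set f k])).
    by apply/seteqP; split => // t _; have [k kM Xk] := Xf t; exists k.
  by have /= -> := congr1 fine (probability_setT P).
apply: esum_ge; exists (f @` `I_M).
  by split => //; apply: finite_image; exact: finite_II.
rewrite fsbig_image; last by move=> i j _ _; exact: finj.
rewrite -fsbig_ord sumEFin lee_fin.
have l2 : 0 < ln 2 :> R by rewrite ln_gt0// ltr1n.
apply: le_trans (_ : \sum_(k < M) (p k * (1 - ln S) - p k ^+ 2 / S) / ln 2 <= _); last first.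
  apply: ler_sum => k _ /=; rewrite /log2 -/(p k).
  have -> : - (p k * (ln (p k) / ln 2)) = - (p k * ln (p k)) / ln 2 by rewrite mulrA mulNr.
  rewrite ler_pM2r ?invr_gt0//.
  by apply: ln_ge_tangent => //; exact: fine_prob_ge0.
rewrite -mulr_suml sumrB -!mulr_suml sum_p mul1r /log2 -mulNr ler_pM2r ?invr_gt0//.
have : (\sum_(i < M) p i ^+ 2) / S <= 1 by rewrite ler_pdivrMr// mul1r.
lra.
Qed.

End entropy_bound.

(** * Energy bound from the Frostman condition *)

Section layers_bound.
Context d (T : measurableType d) (R : realType) (P : probability T R).
Variables V1 V2 : T -> R.
Hypothesis mV1 : measurable_fun setT V1.
Hypothesis mV2 : measurable_fun setT V2.
Let V t : R := Num.sqrt (V1 t ^+ 2 + V2 t ^+ 2).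
Variables C s2 b : R.
Hypothesis b0 : 0 < b.
Hypothesis bs2 : b < 2 `^ s2.
Hypothesis frost : forall rho : R, 0 < rho -> (P [set t | (V t < rho)%R] <= (C * rho `^ s2)%:E)%E.

Let PT : (P setT < +oo)%E.
Proof. by rewrite probability_setT ltry. Qed.

Lemma powR_dyadic i : (2 / 2 ^+ i) `^ s2 = 2 `^ s2 / (2 `^ s2) ^+ i :> R.
Proof.
have h : (2^-1) `^ s2 * 2 `^ s2 = 1 :> R by rewrite -powRM// mulVf// powR1.
elim: i => [|i IH]; first by rewrite !expr0 !divr1.
have -> : 2 / 2 ^+ i.+1 = (2 / 2 ^+ i) * 2^-1 :> R by rewrite exprSr invfM mulrA.
rewrite powRM ?divr_ge0 ?exprn_ge0// IH exprSr invfM mulrA; congr (_ * _).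
by apply: (mulIf (_ : 2 `^ s2 != 0)); rewrite ?h ?mulVf// gt_eqF// powR_gt0.
Qed.

(** The Frostman condition at radius [2 / 2^i] bounds the mean of the [i]-th layer by a term of a
    geometric series of ratio [b / 2^s2 < 1]; hence the bound is uniform in [m]. *)
Lemma layers_integral_le m :
  \int[P]_t layers b m (V t) <= C * 2 `^ s2 / (1 - b / 2 `^ s2).
Proof.
set g := 2 `^ s2.
have g0 : 0 < g by rewrite powR_gt0.
have bg1 : b / g < 1 by rewrite ltr_pdivrMr// mul1r.
have C0 : 0 <= C.
  have := le_trans (measure_ge0 P _) (frost ltr01).
  by rewrite lee_fin powR1 mulr1.
pose A i := V @^-1` [set` `]-oo, (2 / 2 ^+ i)[].
have mA i : measurable (A i).
  by rewrite /A -[_ @^-1` _]setTI; apply: (measurable_mod mV1 mV2).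
have bA i : @bounded_meas _ T R setT (\1_(A i)).
  split; first exact: measurable_indic.
  by exists 1 => t; rewrite indicE; case: (_ \in _); rewrite ?normr1 ?normr0.
have -> : \int[P]_t layers b m (V t) = \int[P]_t (\sum_(i < m.+1) b ^+ i * \1_(A i) t).
  apply: eq_Rintegral => t _; apply: eq_bigr => i _; congr (_ * _).
  rewrite indicE; congr (nat_of_bool _)%:R; apply/idP/idP; rewrite inE /A/= in_itv//.
rewrite Rintegral_sum//; last by move=> i; apply: bounded_measM => //; exact: bounded_meas_cst.
apply: le_trans (_ : \sum_(i < m.+1) C * g * (b / g) ^+ i <= _).
  apply: ler_sum => i _; rewrite bounded_measZ_int//.
  rewrite expr_div_n mulrCA ler_pM2l ?exprn_gt0//.
  rewrite /Rintegral integral_indic// setIT -lee_fin fineK ?fin_num_measure//.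
  have -> : A i = [set t | V t < 2 / 2 ^+ i].
    by apply/seteqP; split => t; rewrite /A/= in_itv.
  by rewrite -mulrA -powR_dyadic; apply: frost; rewrite divr_gt0// exprn_gt0.
rewrite -mulr_sumr ler_wpM2l ?mulr_ge0 ?(ltW g0)//.
rewrite -[(1 - b / g)^-1]mul1r ler_pdivlMr ?subr_gt0//.
rewrite mulrC -opprB mulNr -subrX1 opprB lerBlDr lerDl exprn_ge0// divr_ge0// ltW//.
Qed.

End layers_bound.

(** * Collision probability *)

Lemma powR_exprn (R : realType) (a x : R) n : 0 <= a -> (a `^ x) ^+ n = (a ^+ n) `^ x.
Proof.
move=> a0; rewrite -[LHS]powR_mulrn ?powR_ge0// -powRrM mulrC powRrM.
by rewrite powR_mulrn.
Qed.

Section bins.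
Context d (T : measurableType d) (R : realType) (P : probability T R).
Variables V1 V2 : T -> R.
Hypothesis mV1 : measurable_fun setT V1.
Hypothesis mV2 : measurable_fun setT V2.
Hypothesis V4 : forall t, V1 t ^+ 2 + V2 t ^+ 2 < 4.
Let V t : R := Num.sqrt (V1 t ^+ 2 + V2 t ^+ 2).
Hypothesis char_cos_ge0 : forall u v, 0 <= char_cos P V1 V2 u v.
Hypothesis char_sin0 : forall u v, \int[P]_t sin (u * V1 t + v * V2 t) = 0.
Variables beta U : R.
Hypothesis beta132 : 1 < beta < 3 / 2.
Let b : R := 2 `^ beta.
Hypothesis U1 : 1 <= U.
Hypothesis layersU : forall m, \int[P]_t layers b m (V t) <= U.
Variable delta : R.
Hypothesis delta01 : 0 < delta <= 1.
Let alpha := beta - 1 / 2.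

Definition bin k : set T :=
  [set t | (k%:R * delta <= V1 t ^+ 2 + V2 t ^+ 2 < k.+1%:R * delta)%R].

Let b14 : 1 < b <= 4.
Proof.
have /andP[b1 b3] := beta132.
have e2 : 2 `^ 2%:R = 4 :> R by rewrite powR_mulrn// expr2; lra.
apply/andP; split.
  have -> : 1 = 2 `^ 0 :> R by rewrite powRr0.
  rewrite /b /powR; case: eqP => [/eqP|_]; first by rewrite pnatr_eq0.
  by rewrite ltr_expR mul0r mulr_gt0 ?ln_gt0 ?ltr1n//; lra.
by rewrite -e2; apply: ler_powR; [rewrite ler1n|lra].
Qed.

Let b28 : b ^+ 2 < 8.
Proof.
have /andP[b1 b3] := beta132.
have -> : 8 = 2 `^ 3%:R :> R by rewrite powR_mulrn// !exprS expr0; lra.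
rewrite /b -powR_mulrn ?powR_ge0// -powRrM /powR; case: eqP => [/eqP|_]; first by rewrite pnatr_eq0.
rewrite ltr_expR ltr_pM2r ?ln_gt0 ?ltr1n//; lra.
Qed.

Let V2E t : V t ^+ 2 = V1 t ^+ 2 + V2 t ^+ 2.
Proof. by rewrite sqr_sqrtr// addr_ge0 ?sqr_ge0. Qed.

Lemma measurable_bin k : measurable (bin k).
Proof.
have m2 : measurable_fun setT (fun t => V1 t ^+ 2 + V2 t ^+ 2).
  by apply: measurable_funD; apply: measurable_funX.
have -> : bin k = (fun t => V1 t ^+ 2 + V2 t ^+ 2) @^-1` [set` `[k%:R * delta, k.+1%:R * delta[].
  by apply/seteqP; split => t; rewrite /bin/= in_itv.
by rewrite -[_ @^-1` _]setTI; apply: m2.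
Qed.

Lemma dyadic_floor (y : R) : 1 <= y -> exists nu : nat, (2 ^ nu)%:R <= y < (2 ^ nu.+1)%:R.
Proof.
move=> y1; have y0 : 0 <= y by lra.
have /andP[ky yk] := truncn_itv y0; set k := Num.truncn y in ky yk.
have k0 : (0 < k)%N by rewrite lt0n; apply/eqP => k0; move: yk; rewrite k0; lra.
have /andP[k1 k2] : (2 ^ trunc_log 2 k <= k < 2 ^ (trunc_log 2 k).+1)%N.
  exact: trunc_log_bounds.
exists (trunc_log 2 k); apply/andP; split; first by apply: le_trans ky; rewrite ler_nat.
by apply: lt_le_trans yk _; rewrite ler_nat.
Qed.

(** For [r = Num.sqrt (k%:R * delta)], an interval of length [delta] for [|V|^2] starting at [r^2]
    confines [|V|] to an interval of length at most [delta / (2 r)]. The annulus estimate with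
    [N = 2^nu] comparable to [r / delta] gives [r^(-1/2) (delta / r)^alpha = r^(- beta)
    delta^alpha]. *)
Lemma bin_prob_le k : (0 < k)%N ->
  fine (P (bin k)) * Num.sqrt (k%:R * delta) `^ beta
    <= annulus_const b * 2 `^ alpha * U * delta `^ alpha.
Proof.
move=> k0; have /andP[d0 d1] := delta01; have /andP[b1 b3] := beta132.
have k1 : 1 <= k%:R :> R by rewrite ler1n.
have kd : delta <= k%:R * delta by rewrite ler_peMl// ltW.
have kd0 : 0 < k%:R * delta by lra.
set r := Num.sqrt _; have r0 : 0 < r by rewrite sqrtr_gt0.
have r2E : r ^+ 2 = k%:R * delta by rewrite sqr_sqrtr// ltW.
have a0 : 0 < alpha by rewrite /alpha; lra.
have Kp : 0 <= annulus_const b.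
  have /andP[bb1 bb4] := b14; have bb0 : 0 < b by lra.
  have s0 : 0 < Num.sqrt 2 :> R by rewrite sqrtr_gt0.
  have sb : Num.sqrt 2 * b < 4.
    rewrite -(@ltr_pXn2r _ 2) ?nnegrE ?mulr_ge0 ?(ltW s0) ?(ltW bb0)// exprMn sqr_sqrtr//.
    by apply: lt_le_trans (_ : 2 * 8 <= _); [rewrite ltr_pM2l|lra].
  have c1 : 0 < (Num.sqrt 2)^-1 * (4 / b) - 1.
    by rewrite subr_gt0 mulrCA -invfM ltr_pdivlMr ?mulr_gt0// mul1r.
  have pi0 := @pi_ge0 R.
  have q1 : 0 <= 4 / b by rewrite divr_ge0// ltW.
  have X0 : 0 <= (2 * pi + 4) * (2 * pi) * (32 * (16 / b) ^+ 2 * (4 / b)).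
    apply: mulr_ge0; first by apply: mulr_ge0; lra.
    by apply: mulr_ge0 => //; apply: mulr_ge0 => //; exact: sqr_ge0.
  have := divr_ge0 X0 (ltW c1); rewrite /annulus_const; lra.
have U0 : 0 <= U by exact: le_trans U1.
have rhs0 : 0 <= annulus_const b * 2 `^ alpha * U * delta `^ alpha.
  by apply: mulr_ge0 (powR_ge0 _ _); apply: mulr_ge0 => //; apply: mulr_ge0 (powR_ge0 _ _).
have [r2|r2] := leP r 2; last first.
  have -> : bin k = set0.
    apply/seteqP; split => // t; rewrite /bin/= -r2E => /andP[rt _].
    have := V4 t; have : 2 ^+ 2 < r ^+ 2 by rewrite ltr_pXn2r ?nnegrE ?(ltW r0).
    by rewrite expr2; lra.
  by rewrite measure0 mul0r.
have rd1 : 1 <= r / delta.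
  rewrite ler_pdivlMr// mul1r -(@ler_pXn2r _ 2) ?nnegrE ?(ltW r0) ?(ltW d0)// r2E.
  by apply: le_trans kd; rewrite expr2 ler_piMl// ltW.
have [nu /andP[n1 n2]] := dyadic_floor rd1.
have Ar t : bin k t -> `|V t - r| <= 1 / (2 * (2 ^ nu)%:R).
  rewrite /bin/= -V2E -natr1 mulrDl mul1r -r2E => /andP[t1 t2].
  have Vr : r <= V t by rewrite -(@ler_pXn2r _ 2) ?nnegrE ?(ltW r0) ?sqrtr_ge0.
  rewrite ger0_norm ?subr_ge0// ler_pdivlMr ?mulr_gt0 ?ltr0n ?expn_gt0//.
  have : (V t - r) * (2 * r) <= delta by nra.
  have : (V t - r) * (2 * (2 ^ nu)%:R) <= (V t - r) * (2 * (r / delta)).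
    by rewrite ler_wpM2l ?subr_ge0// ler_pM2l.
  move=> /le_trans + h; apply.
  by rewrite !mulrA ler_pdivrMr// mul1r -mulrA.
have := annulus_prob_le mV1 mV2 V4 char_cos_ge0 char_sin0 b14 U1 layersU
  (introT andP (conj r0 r2)) b28 (measurable_bin k) Ar.
set p := fine _ => hp.
have rb : r `^ beta = Num.sqrt r * r `^ alpha.
  rewrite -powR12_sqrt ?(ltW r0)// -powRD; last by apply/implyP => _; rewrite gt_eqF.
  by congr (_ `^ _); rewrite /alpha; field.
have sr0 : 0 < Num.sqrt r by rewrite sqrtr_gt0.
have e1 : p * r `^ beta <= annulus_const b * U * ((Num.sqrt 2 / b) ^+ nu * r `^ alpha).
  apply: le_trans (ler_wpM2r (powR_ge0 r beta) hp) _.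
  by rewrite rb le_eqVlt; apply/orP; left; apply/eqP; field; rewrite gt_eqF.
apply: le_trans e1 _.
have -> : annulus_const b * 2 `^ alpha * U * delta `^ alpha =
  annulus_const b * U * (2 `^ alpha * delta `^ alpha) by ring.
apply: ler_wpM2l; first by rewrite mulr_ge0.
have rle : r `^ alpha <= (2 `^ alpha) ^+ nu * (2 `^ alpha * delta `^ alpha).
  apply: le_trans (_ : (2 ^+ nu.+1 * delta) `^ alpha <= _).
    apply: ge0_ler_powR; rewrite ?nnegrE ?(ltW a0) ?(ltW r0) ?mulr_ge0 ?exprn_ge0 ?(ltW d0)//.
    by rewrite -ler_pdivrMr// ltW// -natrX.
  rewrite powRM ?exprn_ge0// ?(ltW d0)// exprSr powRM ?exprn_ge0//.
  rewrite -mulrA ler_pM2r ?mulr_gt0 ?powR_gt0//.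
  by rewrite powR_exprn.
apply: le_trans (ler_wpM2l _ rle) _.
  by rewrite exprn_ge0// divr_ge0 ?sqrtr_ge0// powR_ge0.
rewrite [leLHS]mulrA -exprMn.
have -> : Num.sqrt 2 / b * 2 `^ alpha = 1.
  rewrite -powR12_sqrt// /b mulrAC -powRD; last by apply/implyP => _; rewrite gt_eqF.
  have -> : 2^-1 + alpha = beta by rewrite /alpha; field.
  by rewrite divff// gt_eqF// powR_gt0.
by rewrite expr1n mul1r.
Qed.

Let bm_lay m := bounded_meas_layers mV1 mV2 b m.
Let bm_bin k : @bounded_meas _ T R setT (\1_(bin k)).
Proof.
split; first exact/measurable_indic/measurable_bin.
by exists 1 => t; rewrite indicE; case: (_ \in _); rewrite ?normr1 ?normr0.
Qed.
Let PT : (P setT < +oo)%E.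
Proof. by rewrite probability_setT ltry. Qed.

Let bin_layers m k := \int[P]_t (\1_(bin k) t * layers b m (V t)).

Let bin_disjoint j k t : bin j t -> bin k t -> j = k.
Proof.
have /andP[d0 _] := delta01; rewrite /bin/= => /andP[j1 j2] /andP[k1 k2].
have := le_lt_trans j1 k2; have := le_lt_trans k1 j2.
by rewrite !ltr_pM2r// !ltr_nat !ltnS => kj jk; apply/eqP; rewrite eqn_leq jk.
Qed.

Let layers_ge0 m t : 0 <= layers b m (V t).
Proof. by rewrite sumr_ge0// => i _; rewrite mulr_ge0// exprn_ge0// powR_ge0. Qed.

Let bin_layers_ge0 m k : 0 <= bin_layers m k.
Proof. by apply: Rintegral_ge0 => t _; rewrite mulr_ge0 ?layers_ge0. Qed.

Let sum_bin_layers m M : \sum_(k < M) bin_layers m k <= U.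
Proof.
apply: le_trans (layersU m); rewrite /bin_layers -Rintegral_sum//; last first.
  by move=> k; apply: bounded_measM; [exact: bm_bin|exact: bm_lay].
apply: bounded_meas_le => //.
- by apply: bounded_meas_sum => // k; apply: bounded_measM; [exact: bm_bin|exact: bm_lay].
move=> t _; rewrite -mulr_suml ler_piMl ?layers_ge0//.
have [[k kt]|h] := pselect (exists k : 'I_M, bin k t).
  rewrite (bigD1 k)//= big1 ?addr0 => [|j jk].
    by rewrite indicE; case: (_ \in _).
  rewrite indicE memNset// => jt; move/eqP: jk; apply; apply/val_inj.
  exact: bin_disjoint jt kt.
rewrite big1// => k _; rewrite indicE memNset// => kt; apply: h; by exists k.
Qed.

Let prob_le_bin_layers m k (c : R) : 0 <= c ->
  (forall t, bin k t -> 1 <= c * layers b m (V t)) ->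
  fine (P (bin k)) <= c * bin_layers m k.
Proof.
move=> c0 h.
have -> : fine (P (bin k)) = \int[P]_t \1_(bin k) t.
  by rewrite /Rintegral integral_indic ?setIT//; exact: measurable_bin.
have bM : @bounded_meas _ T R setT (fun t => \1_(bin k) t * layers b m (V t)).
  by apply: bounded_measM; [exact: bm_bin|exact: bm_lay].
rewrite -bounded_measZ_int//; apply: bounded_meas_le => //.
  by apply: bounded_measM => //; exact: bounded_meas_cst.
move=> t _; rewrite indicE; have [kt|_] := boolP (t \in bin k).
  by rewrite mul1r; apply: h; rewrite inE in kt.
by rewrite mul0r mulr0.
Qed.

(** The first summand serves the bins with [k > 0], on which [|V|] is at most [Num.sqrt 2] times the
    inner radius; the 1 serves the bin at the origin. *)
Definition collision_const : R :=
  Num.sqrt 2 `^ beta * (annulus_const b * 2 `^ alpha) + 1.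

(** One factor of [P (bin k)^2] is bounded by [bin_prob_le], at the cost of [r^(- beta)]; the other
    by [r^beta] times the energy in the bin, because the layers are at least of order [r^(- beta)]
    there. The powers of [r] cancel, and the energies of the disjoint bins add up to at most [U]. *)
Lemma collision_le M :
  \sum_(k < M) fine (P (bin k)) ^+ 2 <= collision_const * U ^+ 2 * delta `^ alpha.
Proof.
have /andP[d0 d1] := delta01; have /andP[b1 b3] := beta132.
have U0 : 0 <= U by exact: le_trans U1.
have b0 : 0 <= b by exact: powR_ge0.
have beta0 : 0 <= beta by lra.
have sd0 : 0 < Num.sqrt delta by rewrite sqrtr_gt0.
have sd1 : 1 <= (Num.sqrt delta)^-1.
  by rewrite invf_ge1// -sqrtr1 ler_wsqrtr.
(* The resolution [2^(- m)] is comparable to [Num.sqrt delta], the least inner radius of a bin with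
   [k > 0]. *)
have [nu /andP[n1 n2]] := dyadic_floor sd1; pose m := nu.+1.
have m1 : 1 / 2 ^+ m <= Num.sqrt delta.
  by rewrite ler_pdivrMr ?exprn_gt0// -ler_pdivrMl// mulr1 -natrX ltW.
have m2 : Num.sqrt delta <= 2 / 2 ^+ m.
  rewrite exprS invfM mulrA divff// mul1r -[leLHS]invrK lef_pV2 ?posrE ?invr_gt0 ?exprn_gt0//.
  by rewrite -natrX.
have bi i : b ^+ i = (2 ^+ i) `^ beta.
  by rewrite /b powR_exprn.
have s2 : 0 < Num.sqrt 2 :> R by rewrite sqrtr_gt0.
have s22 : Num.sqrt 2 ^+ 2 = 2 :> R by rewrite sqr_sqrtr.
have p0 k := fine_prob_ge0 P (bin k).
(* The sign is read off [bin_prob_le] at [k = 1], whose left-hand side is nonnegative. *)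
have AC : 0 <= Num.sqrt 2 `^ beta * (annulus_const b * 2 `^ alpha) * U * delta `^ alpha.
  have := @bin_prob_le 1 isT; have := mulr_ge0 (p0 1%N) (powR_ge0 (Num.sqrt (1%:R * delta)) beta).
  move=> /le_trans h /h h1; have := mulr_ge0 (powR_ge0 (Num.sqrt 2 : R) beta) h1.
  by rewrite !mulrA.
suff main k : fine (P (bin k)) ^+ 2 <= collision_const * U * delta `^ alpha * bin_layers m k.
  apply: le_trans (_ : \sum_(k < M) collision_const * U * delta `^ alpha * bin_layers m k <= _).
    by apply: ler_sum.
  rewrite -mulr_sumr; apply: le_trans (ler_wpM2l _ (sum_bin_layers m M)) _.
    have -> : collision_const * U * delta `^ alpha =
        Num.sqrt 2 `^ beta * (annulus_const b * 2 `^ alpha) * U * delta `^ alpha + U * delta `^ alpha.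
      by rewrite /collision_const; ring.
    by apply: addr_ge0 => //; exact: mulr_ge0 (powR_ge0 _ _).
  by rewrite le_eqVlt; apply/orP; left; apply/eqP; ring.
have V0 t : 0 <= V t by exact: sqrtr_ge0.
(* At the origin the inner radius vanishes, so the energy bounds both factors. This yields
   [delta^beta], which is at most [delta^alpha] because [delta <= 1]. *)
have [->|k0] := posnP k.
  have h0 : fine (P (bin 0)) <= Num.sqrt delta `^ beta * bin_layers m 0.
    apply: prob_le_bin_layers => [|t]; first exact: powR_ge0.
    rewrite /bin/= mul0r mul1r -V2E => /andP[_ Vd].
    have Vsd : V t < Num.sqrt delta.
      by rewrite -(@ltr_pXn2r _ 2) ?nnegrE ?(ltW sd0)// [ltRHS]sqr_sqrtr ?(ltW d0).
    apply: le_trans (_ : Num.sqrt delta `^ beta * b ^+ m <= _); last first.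
      by rewrite ler_wpM2l ?powR_ge0//; apply: layers_ge => //; exact: lt_le_trans Vsd m2.
    rewrite bi -powRM ?exprn_ge0 ?(ltW sd0)//.
    rewrite -[leLHS](_ : 1 `^ beta = 1); last by rewrite powR1.
    apply: ge0_ler_powR; rewrite ?nnegrE ?mulr_ge0 ?exprn_ge0 ?(ltW sd0)//.
    by rewrite -ler_pdivrMr ?exprn_gt0.
  have LU : bin_layers m 0 <= U.
    by apply: le_trans (sum_bin_layers m 1); rewrite big_ord1.
  have e : Num.sqrt delta `^ beta * Num.sqrt delta `^ beta <= delta `^ alpha.
    rewrite -powRM ?(ltW sd0)// -expr2 sqr_sqrtr ?(ltW d0)//.
    by apply: ger_powR; [rewrite d0|rewrite /alpha; lra].
  apply: le_trans (_ : (Num.sqrt delta `^ beta * bin_layers m 0) ^+ 2 <= _).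
    by rewrite ler_pXn2r ?nnegrE// mulr_ge0 ?powR_ge0.
  apply: le_trans (_ : U * delta `^ alpha * bin_layers m 0 <= _).
    rewrite exprMn expr2 [bin_layers m 0 ^+ 2]expr2 mulrA ler_wpM2r//.
    by rewrite [leRHS]mulrC ler_pM// mulr_ge0 ?powR_ge0.
  rewrite ler_wpM2r// /collision_const mulrDl mul1r mulrDl lerDr.
  exact: AC.
set r := Num.sqrt (k%:R * delta).
have k1 : 1 <= k%:R :> R by rewrite ler1n.
have kd : delta <= k%:R * delta by rewrite ler_peMl// ltW.
have kd0 : 0 < k%:R * delta by lra.
have r0 : 0 < r by rewrite sqrtr_gt0.
have r2E : r ^+ 2 = k%:R * delta by rewrite sqr_sqrtr// ltW.
have h1 : fine (P (bin k)) <= Num.sqrt 2 `^ beta * r `^ beta * bin_layers m k.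
  apply: prob_le_bin_layers => [|t]; first by rewrite mulr_ge0 ?powR_ge0.
  rewrite /bin/= -V2E -natr1 mulrDl mul1r -r2E => /andP[t1 t2].
  have Vr : r <= V t by rewrite -(@ler_pXn2r _ 2) ?nnegrE ?(ltW r0).
  have V2r : V t <= Num.sqrt 2 * r.
    rewrite -(@ler_pXn2r _ 2) ?nnegrE ?mulr_ge0 ?(ltW r0) ?(ltW s2)//.
    by rewrite exprMn s22; lra.
  have sdr : Num.sqrt delta <= r by exact: ler_wsqrtr.
  have Vlt2 : V t < 2.
    rewrite -(@ltr_pXn2r _ 2) ?nnegrE// V2E; apply: lt_le_trans (V4 t) _.
    by rewrite expr2; lra.
  have [i [im vi h]] := dyadic_scale m Vlt2.
  have iV : 1 / 2 ^+ i <= V t.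
    by case: h => // ->; apply: le_trans m1 (le_trans sdr Vr).
  apply: le_trans (_ : Num.sqrt 2 `^ beta * r `^ beta * b ^+ i <= _); last first.
    by apply: ler_wpM2l; [rewrite mulr_ge0 ?powR_ge0|exact: layers_ge].
  rewrite bi -powRM ?(ltW s2) ?(ltW r0)// -powRM ?mulr_ge0 ?exprn_ge0 ?(ltW s2) ?(ltW r0)//.
  rewrite -[leLHS](_ : 1 `^ beta = 1); last by rewrite powR1.
  apply: ge0_ler_powR;
    rewrite ?nnegrE ?mulr_ge0 ?exprn_ge0 ?(ltW s2) ?(ltW r0)//.
  by rewrite -ler_pdivrMr ?exprn_gt0//; exact: le_trans iV V2r.
have h2 := bin_prob_le k0; rewrite -/r in h2.
apply: le_trans (_ : fine (P (bin k)) * (Num.sqrt 2 `^ beta * r `^ beta * bin_layers m k) <= _).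
  by rewrite expr2 ler_wpM2l.
have -> : fine (P (bin k)) * (Num.sqrt 2 `^ beta * r `^ beta * bin_layers m k) =
  Num.sqrt 2 `^ beta * bin_layers m k * (fine (P (bin k)) * r `^ beta) by ring.
apply: le_trans (ler_wpM2l _ h2) _; first by rewrite mulr_ge0 ?powR_ge0.
rewrite /collision_const !mulrDl mul1r.
have -> : Num.sqrt 2 `^ beta * bin_layers m k * (annulus_const b * 2 `^ alpha * U * delta `^ alpha)
  = Num.sqrt 2 `^ beta * (annulus_const b * 2 `^ alpha) * U * delta `^ alpha * bin_layers m k by ring.
by rewrite lerDl !mulr_ge0 ?powR_ge0.
Qed.

End bins.

(** * Dyadic truncation of the squared distance *)

Section dyadic_truncation.
Context d (T : measurableType d) (R : realType) (P : probability T R).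

Lemma Dn_eq n (z : R) (m : int) :
  Dn n z = m%:~R / 2 ^+ n <-> m%:~R <= 2 ^+ n * z < (m + 1)%:~R.
Proof.
have n0 : (2 : R) ^+ n != 0 by rewrite expf_neq0.
rewrite /Dn; split => [/(mulIf (invr_neq0 n0)) /intr_inj <-|/floor_def -> //].
exact: floor_itv.
Qed.

Lemma measurable_Dn_preimage n (Z : T -> R) (v : R) : measurable_fun setT Z ->
  measurable ((fun t => Dn n (Z t)) @^-1` [set v]).
Proof.
move=> mZ.
have n0 : (2 : R) ^+ n != 0 by rewrite expf_neq0.
have mY : measurable_fun setT (fun t => 2 ^+ n * Z t) by apply: measurable_funM.
have [[m vE]|h] := pselect (exists m : int, v = m%:~R / 2 ^+ n).
  have -> : (fun t => Dn n (Z t)) @^-1` [set v] =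
      (fun t => 2 ^+ n * Z t) @^-1` [set` `[m%:~R, (m + 1)%:~R[].
    by apply/seteqP; split => t; rewrite /= in_itv/= vE => /Dn_eq.
  by rewrite -[_ @^-1` _]setTI; apply: mY.
have -> : (fun t => Dn n (Z t)) @^-1` [set v] = set0; last exact: measurable0.
apply/seteqP; split => // t /= tv; apply: h; by exists (Num.floor (2 ^+ n * Z t)).
Qed.

Lemma prob_eq_off_null (N A B : set T) : measurable N -> P N = 0%E ->
  measurable A -> measurable B -> (forall t, ~ N t -> A t <-> B t) -> P A = P B.
Proof.
move=> mN N0 mA mB AB.
rewrite -(measureU0 mA mN N0) -(measureU0 mB mN N0); congr (P _).
apply/seteqP; split => t /=; have [Nt|Nt] := pselect (N t); (try by right).
  by move=> [/(AB t Nt) ?|//]; left.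
by move=> [/(AB t Nt) ?|//]; left.
Qed.

Lemma eq_Hn_off_null n (N : set T) (Z Z' : T -> R) : measurable N -> P N = 0%E ->
  measurable_fun setT Z -> measurable_fun setT Z' ->
  (forall t, ~ N t -> Z t = Z' t) -> Hn P n Z = Hn P n Z'.
Proof.
move=> mN N0 mZ mZ' ZZ'; apply: eq_esum => v _.
rewrite (prob_eq_off_null mN N0 (measurable_Dn_preimage n v mZ)
  (measurable_Dn_preimage n v mZ'))// => t Nt.
by rewrite /= ZZ'.
Qed.

End dyadic_truncation.

(** * Entropy bound for variables bounded everywhere *)

Section bounded_case.
Context d (T : measurableType d) (R : realType) (P : probability T R).

(** The constant of [layers_integral_le] for [b = 2^beta] and exponent [2 * s], without the Frostman
    constant; the maximum secures [1 <= U]. *)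
Definition layers_const (s beta : R) : R :=
  Num.max 1 (2 `^ (2 * s) / (1 - 2 `^ beta / 2 `^ (2 * s))).

Lemma Hn_ge_bounded (s beta C Rad : R) (W W' : T -> R * R) (n : nat) :
  1 / 2 < s < 1 -> 1 < beta < 3 / 2 -> beta < 2 * s -> 0 < C -> 1 <= Rad ->
  measurable_fun setT W -> measurable_fun setT W' ->
  frostman P W (2 * s) C ->
  (forall t, norm2 (W t) < Rad) -> (forall t, norm2 (W' t) < Rad) ->
  independent2 P W W' -> same_distr P W W' ->
  ((- log2 (Num.max 1 (collision_const beta)
      * (layers_const s beta * Num.max 1 C * Rad ^+ 2) ^+ 2
      * (1 / (2 ^+ n * Rad ^+ 2)) `^ (beta - 1 / 2)))%:E
    <= Hn P n (fun t => (((W t).1 - (W' t).1) ^+ 2 + ((W t).2 - (W' t).2) ^+ 2)%R))%E.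
Proof.
move=> /andP[s1 s2] beta132 bs C0 Rad1 mW mW' frost WR W'R indep same.
have Rad0 : 0 < Rad by exact: lt_le_trans Rad1.
have Radn0 : Rad != 0 by rewrite gt_eqF.
have n0 : 0 < (2 : R) ^+ n by rewrite exprn_gt0.
pose V1 t := Rad^-1 * ((W t).1 - (W' t).1).
pose V2 t := Rad^-1 * ((W t).2 - (W' t).2).
pose Z t := ((W t).1 - (W' t).1) ^+ 2 + ((W t).2 - (W' t).2) ^+ 2.
have mV1 : measurable_fun setT V1.
  by apply: measurable_funM => //; apply: measurable_funB; exact: measurableT_comp.
have mV2 : measurable_fun setT V2.
  by apply: measurable_funM => //; apply: measurable_funB; exact: measurableT_comp.
have ZE t : Z t = Rad ^+ 2 * (V1 t ^+ 2 + V2 t ^+ 2).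
  by rewrite /Z /V1 /V2; field.
have V4 t : V1 t ^+ 2 + V2 t ^+ 2 < 4.
  have sq (x : R * R) : norm2 x < Rad -> x.1 ^+ 2 + x.2 ^+ 2 < Rad ^+ 2.
    move=> xR; rewrite -[ltLHS]sqr_sqrtr ?addr_ge0 ?sqr_ge0//.
    by rewrite ltr_pXn2r ?nnegrE ?sqrtr_ge0// ltW.
  rewrite -(@ltr_pM2l _ (Rad ^+ 2)) ?exprn_gt0// -ZE /Z.
  have := sq _ (WR t); have := sq _ (W'R t).
  have := sqr_ge0 ((W t).1 + (W' t).1); have := sqr_ge0 ((W t).2 + (W' t).2).
  nra.
have cc0 u v : 0 <= char_cos P V1 V2 u v.
  have -> : char_cos P V1 V2 u v = \int[P]_t cos ((u / Rad) * ((W t).1 - (W' t).1) +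
      (v / Rad) * ((W t).2 - (W' t).2)).
    by apply: eq_Rintegral => t _; rewrite /V1 /V2 !mulrA.
  by rewrite (char_cos_diff mW mW' indep same) addr_ge0 ?sqr_ge0.
have cs0 u v : \int[P]_t sin (u * V1 t + v * V2 t) = 0.
  rewrite -(char_sin_diff mW mW' indep same (u / Rad) (v / Rad)).
  by apply: eq_Rintegral => t _; rewrite /V1 /V2 !mulrA.
have /andP[beta1 beta2] := beta132.
have b0 : 0 < 2 `^ beta :> R by rewrite powR_gt0.
have g0 : 0 < 2 `^ (2 * s) :> R by rewrite powR_gt0.
have bg : 2 `^ beta < 2 `^ (2 * s) :> R.
  rewrite /powR; case: eqP => [/eqP|_]; first by rewrite pnatr_eq0.
  by rewrite ltr_expR ltr_pM2r// ln_gt0// ltr1n.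
pose C' := C * Rad `^ (2 * s).
have frost' rho : 0 < rho ->
    (P [set t | (Num.sqrt (V1 t ^+ 2 + V2 t ^+ 2) < rho)%R] <= (C' * rho `^ (2 * s))%:E)%E.
  move=> rho0; have Rr : 0 < Rad * rho by rewrite mulr_gt0.
  have := frostman_diff mW mW' frost indep same Rr.
  rewrite powRM ?(ltW Rad0) ?(ltW rho0)// mulrA -/C'; congr (P _ <= _)%E.
  apply/seteqP; split => t /=; rewrite -/(Z t) ZE sqrtrM ?sqr_ge0// sqrtr_sqr (gtr0_norm Rad0) ltr_pM2l//.
have layU m := layers_integral_le mV1 mV2 b0 bg frost' m.
set U := layers_const s beta * Num.max 1 C * Rad ^+ 2.
have U1 : 1 <= U.
  rewrite /U /layers_const; apply: mulr_ege1; last by rewrite exprn_ege1.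
  by apply: mulr_ege1; rewrite le_max lexx.
(* Rounding the exponent up to 2 makes the power of [Rad] in [U] independent of [s]. *)
have R2 : Rad `^ (2 * s) <= Rad ^+ 2.
  by rewrite -powR_mulrn ?(ltW Rad0)//; apply: ler_powR => //; lra.
have layU' m : \int[P]_t layers (2 `^ beta) m (Num.sqrt (V1 t ^+ 2 + V2 t ^+ 2)) <= U.
  apply: le_trans (layU m) _; rewrite /C' /U.
  have L0 : 0 <= 2 `^ (2 * s) / (1 - 2 `^ beta / 2 `^ (2 * s)) :> R.
    by rewrite divr_ge0 ?(ltW g0)// subr_ge0 ler_pdivrMr// mul1r ltW.
  have -> : C * Rad `^ (2 * s) * 2 `^ (2 * s) / (1 - 2 `^ beta / 2 `^ (2 * s)) =
    2 `^ (2 * s) / (1 - 2 `^ beta / 2 `^ (2 * s)) * C * Rad `^ (2 * s) by ring.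
  apply: ler_pM => //; [by rewrite mulr_ge0// ltW|exact: powR_ge0|].
  apply: ler_pM => //; [exact: ltW| |]; by rewrite le_max lexx orbT.
(* With this width [2^n |W - W'|^2 = |V|^2 / delta], so the bins are exactly the level sets of
   [Dn n]. *)
set delta := 1 / (2 ^+ n * Rad ^+ 2).
have dp : 0 < 2 ^+ n * Rad ^+ 2 by rewrite mulr_gt0// exprn_gt0.
have d01 : 0 < delta <= 1.
  rewrite divr_gt0//= ler_pdivrMr// mul1r; apply: mulr_ege1; rewrite exprn_ege1//.
  by rewrite ler1n.
have /andP[d0 d1] := d01.
have coll M := collision_le mV1 mV2 V4 cc0 cs0 beta132 U1 layU' d01 M.
pose f (k : nat) : R := k%:R / 2 ^+ n.
have binE k : (fun t => Dn n (Z t)) @^-1` [set f k] = bin V1 V2 delta k.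
  have e t : 2 ^+ n * Z t = (V1 t ^+ 2 + V2 t ^+ 2) / delta.
    by rewrite ZE /delta; field; rewrite Radn0 gt_eqF.
  apply/seteqP; split => t /=.
    move=> h; have /Dn_eq : Dn n (Z t) = k%:~R / 2 ^+ n := h.
    by rewrite e ler_pdivlMr// ltr_pdivrMr// intrD /bin/= -natr1.
  rewrite /bin/= -natr1 => h; have /Dn_eq // : k%:Z%:~R <= 2 ^+ n * Z t < (k%:Z + 1)%:~R.
  by rewrite e ler_pdivlMr// ltr_pdivrMr// intrD.
apply: (@entropy_ge_collision _ _ _ _ _ f (Num.truncn (4 / delta)).+1).
- move=> i j /(mulIf (invr_neq0 (lt0r_neq0 n0))) /eqP; rewrite eqr_nat => /eqP //.
- move=> t; set v := V1 t ^+ 2 + V2 t ^+ 2.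
  have v0 : 0 <= v by rewrite addr_ge0 ?sqr_ge0.
  exists (Num.truncn (v / delta)).
    rewrite ltnS; apply: le_truncn; rewrite ler_pM2r ?invr_gt0//; exact/ltW/V4.
  have : bin V1 V2 delta (Num.truncn (v / delta)) t.
    rewrite /bin/= -ler_pdivlMr// -ltr_pdivrMr//; apply: truncn_itv.
    by rewrite divr_ge0// ltW.
  by rewrite -binE.
- by move=> k; rewrite binE; exact: measurable_bin.
- rewrite mulr_gt0 ?powR_gt0// mulr_gt0 ?exprn_gt0// ?(lt_le_trans _ U1)//.
  by rewrite lt_max ltr01.
- under eq_bigr do rewrite binE.
  apply: le_trans (coll _) _.
  rewrite ler_wpM2r ?powR_ge0// ler_wpM2r ?sqr_ge0//.
  by rewrite le_max lexx orbT.
Qed.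

End bounded_case.

(** * Replacing the copy by one bounded everywhere *)

Section truncated_copy.
Context d (T : measurableType d) (R : realType) (P : probability T R).
Variables (W W' : T -> R * R) (Rad : R).
Hypothesis mW : measurable_fun setT W.
Hypothesis mW' : measurable_fun setT W'.
Hypothesis Rad0 : 0 < Rad.
Hypothesis WR : forall t, norm2 (W t) < Rad.
Hypothesis indep : independent2 P W W'.
Hypothesis same : same_distr P W W'.

(* The hypothesis [norm2 (W t) < Rad] holds everywhere but only bounds [W'] almost
surely. *)
Definition truncated_copy t : R * R := if norm2 (W' t) < Rad then W' t else (0, 0).

Definition exceptional_set : set T := W' @^-1` [set x | ~~ (norm2 x < Rad)%R].

Let measurable_norm2 : measurable_fun setT (@norm2 R).
Proof.
apply: measurableT_comp; first exact: continuous_measurable_fun (@sqrt_continuous R).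
by apply: measurable_funD; apply: measurable_funX.
Qed.

Let mB : measurable [set x : R * R | ~~ (norm2 x < Rad)%R].
Proof.
have -> : [set x : R * R | ~~ (norm2 x < Rad)%R] = @norm2 R @^-1` [set` `[Rad, +oo[].
  by apply/seteqP; split => x /=; rewrite in_itv/= andbT leNgt.
by rewrite -[_ @^-1` _]setTI; apply: measurable_norm2.
Qed.

Lemma measurable_exceptional_set : measurable exceptional_set.
Proof. by rewrite /exceptional_set -[_ @^-1` _]setTI; apply: mW'. Qed.

Lemma exceptional_set_null : P exceptional_set = 0%E.
Proof.
rewrite /exceptional_set -same//.
have -> : W @^-1` [set x | ~~ (norm2 x < Rad)%R] = set0; last exact: measure0.
by apply/seteqP; split => // t /=; rewrite WR.
Qed.

Lemma truncated_copyE t : ~ exceptional_set t -> truncated_copy t = W' t.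
Proof. by rewrite /exceptional_set/= /truncated_copy => /negP; rewrite negbK => ->. Qed.

Lemma truncated_copy_bounded t : norm2 (truncated_copy t) < Rad.
Proof.
rewrite /truncated_copy; case: ifP => // _.
by rewrite /norm2/= expr0n/= addr0 sqrtr0.
Qed.

Lemma measurable_truncated_copy : measurable_fun setT truncated_copy.
Proof.
apply: measurable_fun_ifT => //.
apply: measurable_fun_ltr => //; exact: measurableT_comp.
Qed.

Let preimage_eq (A : set (R * R)) t : ~ exceptional_set t ->
  (truncated_copy @^-1` A) t <-> (W' @^-1` A) t.
Proof. by move=> Nt; rewrite /preimage/= truncated_copyE. Qed.

Let m_preimage (Q : T -> R * R) (A : set (R * R)) : measurable_fun setT Q ->
  measurable A -> measurable (Q @^-1` A).
Proof. by move=> mQ mA; rewrite -[_ @^-1` _]setTI; apply: mQ. Qed.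

Lemma truncated_copy_same_distr : same_distr P W truncated_copy.
Proof.
move=> A mA; rewrite same//; apply/esym.
apply: (prob_eq_off_null measurable_exceptional_set exceptional_set_null).
- exact: m_preimage measurable_truncated_copy mA.
- exact: m_preimage.
- exact: preimage_eq.
Qed.

Lemma truncated_copy_independent2 : independent2 P W truncated_copy.
Proof.
move=> A B mA mB'; have -> : P (truncated_copy @^-1` B) = P (W' @^-1` B).
  by rewrite -truncated_copy_same_distr// same.
rewrite -indep//.
apply: (prob_eq_off_null measurable_exceptional_set exceptional_set_null).
- by apply: measurableI; [exact: m_preimage|exact: m_preimage measurable_truncated_copy mB'].
- by apply: measurableI; exact: m_preimage.
- by move=> t Nt; split => -[h1 h2]; split => //; apply/(preimage_eq _ Nt).
Qed.

End truncated_copy.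

(** * Choice of exponents and conclusion *)

Lemma eps0_gt0 (R : realType) (s : R) : 1 / 2 < s < 1 -> 0 < eps0 s.
Proof. by move=> /andP[s1 s2]; rewrite /eps0; case: ifP => _; lra. Qed.

(** The two upper bounds amount to [eps0 s < min(s - 1/2, 1 - s)], and [eps0 s] is one third of this
    minimum, whose two terms cross at [s = 3/4]. *)
Lemma eps0_exponent (R : realType) (s : R) : 1 / 2 < s < 1 ->
  1 < s + eps0 s + 1 / 2 < 3 / 2 /\ s + eps0 s + 1 / 2 < 2 * s.
Proof.
move=> /andP[s1 s2]; rewrite /eps0.
have [s3|s3] := leP s (3 / 4).
  split; last by lra.
  by apply/andP; split; lra.
split; last by lra.
by apply/andP; split; lra.
Qed.

Lemma ln_max1 (R : realType) (x : R) : 0 < x -> ln (Num.max 1 x) / ln 2 = logp x.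
Proof.
move=> x0; have l2 : 0 < ln 2 :> R by rewrite ln_gt0// ltr1n.
rewrite /logp /log2; have [x1|x1] := leP x 1.
  by rewrite ln1 mul0r max_r// pmulr_lle0 ?invr_gt0// ln_le0.
by rewrite max_l//; apply: divr_ge0; [exact/ln_ge0/ltW|exact: ltW].
Qed.

Theorem mainTheorem13 (R : realType) :
  exists K : R,
  forall s : R, 1 / 2 < s < 1 ->
  0 < eps0 s /\
  exists Ks : R,
  forall (d : measure_display) (T : measurableType d) (P : probability T R)
         (C Rad : R) (W W' : T -> R * R),
    0 < C -> 0 < Rad ->
    measurable_fun setT W -> measurable_fun setT W' ->
    frostman P W (2 * s) C ->
    (forall t, norm2 (W t) < Rad) ->
    independent2 P W W' -> same_distr P W W' ->
    forall n : nat,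
      ((n%:R * (s + eps0 s) - K * logp C - K * logp Rad - Ks)%:E
        <= Hn P n (fun t => (((W t).1 - (W' t).1) ^+ 2 + ((W t).2 - (W' t).2) ^+ 2)%R))%E.
Proof.
(* The factor [U^2] costs [2 log_+ C + 4 log_+ Rad], and the power of [delta] gives back
   [2 (s + eps0 s) log_+ Rad]; so 4 suffices for every [s]. *)
exists 4 => s s12; split; first exact: eps0_gt0.
pose beta := s + eps0 s + 1 / 2.
have [beta132 betas] := eps0_exponent s12; rewrite -/beta in beta132 betas.
pose K4 := Num.max 1 (collision_const beta).
pose U0 := layers_const s beta.
exists ((ln K4 + 2 * ln U0) / ln 2) => d T P C Rad W W' C0 Rad0 mW mW' frost WR indep same n.
(* [W'] obeys the bound only almost surely; changing it on a null set leaves the entropy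
   unchanged. *)
pose W'' := truncated_copy W' Rad.
have mW'' : measurable_fun setT W'' by exact: measurable_truncated_copy.
have mdist (Q : T -> R * R) : measurable_fun setT Q ->
    measurable_fun setT (fun t => ((W t).1 - (Q t).1) ^+ 2 + ((W t).2 - (Q t).2) ^+ 2).
  move=> mQ; apply: measurable_funD; apply: measurable_funX; apply: measurable_funB;
    exact: measurableT_comp.
rewrite (eq_Hn_off_null n (measurable_exceptional_set Rad mW')
  (exceptional_set_null WR same) (mdist _ mW') (mdist _ mW'')); last first.
  by move=> t Nt; rewrite /W'' truncated_copyE.
pose Rad1 := Num.max 1 Rad.
have R1 : 1 <= Rad1 by rewrite /Rad1 le_max lexx.
have R0 : 0 < Rad1 by exact: lt_le_trans R1.
have le_Rad1 x : x < Rad -> x < Rad1 by move=> xR; rewrite /Rad1 lt_max xR orbT.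
apply: le_trans (Hn_ge_bounded n s12 beta132 betas C0 R1 mW mW'' frost
  (fun t => le_Rad1 _ (WR t)) (fun t => le_Rad1 _ (truncated_copy_bounded W' Rad0 t))
  (truncated_copy_independent2 mW mW' WR indep same)
  (truncated_copy_same_distr mW' WR same)).
rewrite lee_fin -/K4 -/U0 -(ln_max1 C0) -(ln_max1 Rad0) -/Rad1 /log2.
set C1 := Num.max 1 C.
have C1p : 0 < C1 by rewrite lt_max ltr01.
have K4p : 0 < K4 by rewrite lt_max ltr01.
have U0p : 0 < U0 by rewrite lt_max ltr01.
have l2 : 0 < ln 2 :> R by rewrite ln_gt0// ltr1n.
have n0 : 0 < (2 : R) ^+ n by rewrite exprn_gt0.
have -> : beta - 1 / 2 = s + eps0 s by rewrite /beta addrK.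
set al := s + eps0 s.
have al0 : 0 < al by have := eps0_gt0 s12; move/andP: s12 => [s1 s2]; rewrite /al; lra.
have UE : ln ((U0 * C1 * Rad1 ^+ 2) ^+ 2) = 2 * (ln U0 + ln C1 + 2 * ln Rad1).
  rewrite lnXn ?mulr_gt0 ?exprn_gt0// [ln (_ * Rad1 ^+ 2)]lnM ?posrE ?mulr_gt0 ?exprn_gt0//.
  rewrite [ln (U0 * C1)]lnM ?posrE// [ln (Rad1 ^+ 2)]lnXn//; ring.
have dE : ln ((1 / (2 ^+ n * Rad1 ^+ 2)) `^ al) = - al * (n%:R * ln 2 + 2 * ln Rad1).
  rewrite ln_powR div1r lnV ?posrE ?mulr_gt0 ?exprn_gt0// lnM ?posrE ?exprn_gt0// !lnXn//.
  by rewrite -[ln 2 *+ n]mulr_natl; ring.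
have SE : ln (K4 * (U0 * C1 * Rad1 ^+ 2) ^+ 2 * (1 / (2 ^+ n * Rad1 ^+ 2)) `^ al) =
    ln K4 + 2 * (ln U0 + ln C1 + 2 * ln Rad1) - al * (n%:R * ln 2 + 2 * ln Rad1).
  have Sp : 0 < (U0 * C1 * Rad1 ^+ 2) ^+ 2 by rewrite exprn_gt0// !mulr_gt0// exprn_gt0.
  rewrite lnM ?posrE; [|by rewrite mulr_gt0|].
    by rewrite lnM ?posrE// UE dE mulNr.
  by rewrite powR_gt0// divr_gt0// mulr_gt0// exprn_gt0.
rewrite SE -subr_ge0.
have cC : 0 <= ln C1 / ln 2 by rewrite divr_ge0 ?(ltW l2)// ln_ge0// le_max lexx.
have cR : 0 <= ln Rad1 / ln 2 by rewrite divr_ge0 ?(ltW l2)// ln_ge0.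
have -> : - ((ln K4 + 2 * (ln U0 + ln C1 + 2 * ln Rad1) - al * (n%:R * ln 2 + 2 * ln Rad1)) / ln 2)
   - (n%:R * al - 4 * (ln C1 / ln 2) - 4 * (ln Rad1 / ln 2) - (ln K4 + 2 * ln U0) / ln 2)
  = 2 * (ln C1 / ln 2) + 2 * al * (ln Rad1 / ln 2).
  by field; rewrite gt_eqF.
by rewrite addr_ge0// mulr_ge0// mulr_ge0// ltW.
Qed.
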